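(* Let $(\Sigma,g)$ be a smooth compact connected Riemannian surface with nonempty boundary $\partial\Sigma$, with nonnegative Gaussian curvature and with geodesic curvature $\kappa\ge 1$ on the boundary. Let $q>1$ and $0<\lambda\le\frac{1}{q-1}$. Then every positive function $u\in C^\infty(\Sigma)$ satisfying $$\Delta u=0\ \text{ on }\Sigma,\qquad \frac{\partial u}{\partial\nu}+\lambda u=u^{q}\ \text{ on }\partial\Sigma$$ is constant.
   Context: $\nu$ denotes the outer unit normal on $\partial\Sigma$. The geodesic curvature is $\kappa=\langle\nabla_{\partial_s}\nu,\partial_s\rangle$, where $\partial_s$ is a unit tangent vector to $\partial\Sigma$; with this sign convention the boundary of the Euclidean unit disc has $\kappa=1$. $\Delta$ is the Laplace–Beltrami operator. $C^\infty(\Sigma)$ denotes functions smooth up to the boundary. *)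

(* Defs.v *)
(* MathComp world, with MathComp-Analysis over an arbitrary R : realType.

   A smooth surface with boundary is a topological space with an atlas of
   charts onto relatively open subsets of the closed half-plane
   {x | 0 <= x_1} (coordinates x_0, x_1), with smooth transition maps; the
   boundary is what the charts send to the line {x_1 = 0}.  Tensors are given
   by their components in the charts. *)
From HB Require Import structures.
From mathcomp Require Import all_boot all_order all_algebra.
From mathcomp Require Import all_classical all_reals all_analysis.

Set Implicit Arguments.
Unset Strict Implicit.
Unset Printing Implicit Defensive.

Import Order.TTheory GRing.Theory Num.Theory.
Import numFieldNormedType.Exports.

Local Open Scope classical_set_scope.
Local Open Scope ring_scope.

Notation plane R := ('rV[R]_2).

Definition half_plane (R : realType) : set (plane R) :=
  [set x | 0 <= x 0 1].

Definition bvec (R : realType) (i : 'I_2) : plane R := delta_mx 0 i.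

(* F is of class C^n on U; meaningful for U open. *)
Fixpoint Cn (R : realType) (n : nat) (U : set (plane R)) (F : plane R -> R)
    {struct n} : Prop :=
  (forall x, U x -> {for x, continuous F}) /\
  match n with
  | 0%N => True
  | n'.+1 => forall i : 'I_2,
      (forall x, U x -> derivable F x (bvec R i)) /\
      Cn n' U (fun x => 'D_(bvec R i) F x)
  end.

(* Smoothness on an arbitrary subset D of the plane: local existence of smooth
   extensions to open sets.  For D relatively open in the half-plane this is
   smoothness up to the boundary. *)
Definition smooth_on (R : realType) (D : set (plane R)) (f : plane R -> R)
    : Prop :=
  forall x, D x -> exists (U : set (plane R)) (F : plane R -> R),
    [/\ open U, U x, (forall n, Cn n U F) &
        forall y, U y -> D y -> F y = f y].

(* Partial derivative inside the half-plane: the ordinary one at interior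
   points, one-sided in the direction x_1 on the line {x_1 = 0}. *)
Definition pderiv (R : realType) (i : 'I_2) (f : plane R -> R) (x : plane R)
    : R :=
  lim ((fun h : R => h^-1 * (f (x + h *: bvec R i) - f x))
       @ within [set h : R | half_plane (x + h *: bvec R i)] (0 : R)^').

Record chart (R : realType) (S : topologicalType) := Chart {
  cdom : set S ;
  cmap : S -> plane R ;
  cinv : plane R -> S ;
  cdom_open : open cdom ;
  cmapK : forall p, cdom p -> cinv (cmap p) = p ;
  cimg_open : exists U : set (plane R),
    open U /\ cmap @` cdom = U `&` @half_plane R ;
  cmap_continuous : {within cdom, continuous cmap} ;
  cinv_continuous : {within cmap @` cdom, continuous cinv} }.

Definition transition (R : realType) (S : topologicalType) (c d : chart R S)
    (k : 'I_2) : plane R -> R :=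
  fun x => cmap d (cinv c x) 0 k.

Definition transition_jacobian (R : realType) (S : topologicalType)
    (c d : chart R S) (x : plane R) : 'M[R]_2 :=
  \matrix_(k, i) pderiv i (transition c d k) x.

Record smooth_surface (R : realType) (S : topologicalType) := SmoothSurface {
  atlas : set (chart R S) ;
  surface_hausdorff : hausdorff_space S ;
  atlas_cover : forall p : S, exists2 c, atlas c & cdom c p ;
  atlas_smooth : forall c d, atlas c -> atlas d -> forall k : 'I_2,
    smooth_on (cmap c @` (cdom c `&` cdom d)) (transition c d k) }.

(* metric c x is the matrix (g_ij) in the chart c at the point of
   coordinates x; its values for c outside the atlas, or x outside the image
   of c, are irrelevant. *)
Record riemannian_metric (R : realType) (S : topologicalType)
    (M : smooth_surface R S) := RiemannianMetric {
  metric : chart R S -> plane R -> 'M[R]_2 ;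
  metric_smooth : forall c, atlas M c -> forall i j : 'I_2,
    smooth_on (cmap c @` cdom c) (fun x => metric c x i j) ;
  metric_sym : forall c p, atlas M c -> cdom c p ->
    (metric c (cmap c p))^T = metric c (cmap c p) ;
  metric_pos : forall c p, atlas M c -> cdom c p ->
    forall v : plane R, v != 0 ->
      0 < (v *m metric c (cmap c p) *m v^T) 0 0 ;
  metric_change : forall c d p, atlas M c -> atlas M d ->
    cdom c p -> cdom d p ->
    let J := transition_jacobian c d (cmap c p) in
    metric c (cmap c p) = J^T *m metric d (cmap d p) *m J }.

Definition boundary (R : realType) (S : topologicalType)
    (M : smooth_surface R S) : set S :=
  [set p | exists c, [/\ atlas M c, cdom c p & cmap c p 0 1 = 0]].

Definition smooth_function (R : realType) (S : topologicalType)
    (M : smooth_surface R S) (u : S -> R) : Prop :=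
  forall c, atlas M c -> smooth_on (cmap c @` cdom c) (u \o cinv c).

(* Local Riemannian geometry in coordinates, for a matrix field g = (g_ij);
   vector fields are given by their components. *)

Definition inner (R : realType) (g : plane R -> 'M[R]_2) (x v w : plane R)
    : R := (v *m g x *m w^T) 0 0.

Definition christoffel (R : realType) (g : plane R -> 'M[R]_2)
    (k i j : 'I_2) (x : plane R) : R :=
  2^-1 * \sum_(l < 2) invmx (g x) k l *
    (pderiv i (fun y => g y j l) x + pderiv j (fun y => g y i l) x
     - pderiv l (fun y => g y i j) x).

(* Levi-Civita covariant derivative of X along Y *)
Definition nabla (R : realType) (g : plane R -> 'M[R]_2)
    (Y X : plane R -> plane R) (x : plane R) : plane R :=
  \row_(k < 2) \sum_(i < 2) Y x 0 i *
    (pderiv i (fun y => X y 0 k) x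
     + \sum_(j < 2) christoffel g k i j x * X x 0 j).

Definition coord_field (R : realType) (i : 'I_2) : plane R -> plane R :=
  fun _ => bvec R i.

Definition grad (R : realType) (g : plane R -> 'M[R]_2) (f : plane R -> R)
    (x : plane R) : plane R :=
  \row_(i < 2) \sum_(j < 2) invmx (g x) i j * pderiv j f x.

(* div X is the trace of Y |-> nabla_Y X. *)
Definition divergence (R : realType) (g : plane R -> 'M[R]_2)
    (X : plane R -> plane R) (x : plane R) : R :=
  \sum_(k < 2) nabla g (coord_field k) X x 0 k.

Definition laplace_beltrami (R : realType) (g : plane R -> 'M[R]_2)
    (f : plane R -> R) (x : plane R) : R :=
  divergence g (grad g f) x.

(* <R(e_0, e_1) e_1, e_0> / (|e_0|^2 |e_1|^2 - <e_0, e_1>^2), where e_0, e_1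
   are the (commuting) coordinate fields; positive on round spheres. *)
Definition gauss_curvature (R : realType) (g : plane R -> 'M[R]_2)
    (x : plane R) : R :=
  let e0 := @coord_field R 0 in
  let e1 := @coord_field R 1 in
  inner g x (nabla g e0 (nabla g e1 e1) x - nabla g e1 (nabla g e0 e1) x)
    (e0 x) / \det (g x).

(* - grad x_1 / |grad x_1|: on the line {x_1 = 0} it is the unit vector
   orthogonal to that line and pointing out of the half-plane. *)
Definition outer_normal (R : realType) (g : plane R -> 'M[R]_2) (x : plane R)
    : plane R :=
  let n := grad g (fun y => y 0 1) x in
  - ((Num.sqrt (inner g x n n))^-1 *: n).

(* On the line {x_1 = 0}, a unit vector tangent to that line. *)
Definition unit_tangent (R : realType) (g : plane R -> 'M[R]_2) (x : plane R)
    : plane R :=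
  (Num.sqrt (inner g x (bvec R 0) (bvec R 0)))^-1 *: bvec R 0.

(* Only used on the line {x_1 = 0}, where nabla_tau differentiates the normal
   along that line only. *)
Definition geodesic_curvature (R : realType) (g : plane R -> 'M[R]_2)
    (x : plane R) : R :=
  inner g x (nabla g (unit_tangent g) (outer_normal g) x) (unit_tangent g x).

Definition normal_derivative (R : realType) (g : plane R -> 'M[R]_2)
    (f : plane R -> R) (x : plane R) : R :=
  \sum_(i < 2) outer_normal g x 0 i * pderiv i f x.

(* The quantities above do not depend on the chart; conditions on them are
   imposed in every chart of the atlas around the point. *)

Definition nonneg_gauss_curvature (R : realType) (S : topologicalType)
    (M : smooth_surface R S) (g : riemannian_metric M) : Prop :=
  forall c p, atlas M c -> cdom c p ->
    0 <= gauss_curvature (metric g c) (cmap c p).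

Definition geodesic_curvature_ge (R : realType) (S : topologicalType)
    (M : smooth_surface R S) (g : riemannian_metric M) (k : R) : Prop :=
  forall c p, atlas M c -> cdom c p -> boundary M p ->
    k <= geodesic_curvature (metric g c) (cmap c p).

Definition harmonic_function (R : realType) (S : topologicalType)
    (M : smooth_surface R S) (g : riemannian_metric M) (u : S -> R) : Prop :=
  forall c p, atlas M c -> cdom c p ->
    laplace_beltrami (metric g c) (u \o cinv c) (cmap c p) = 0.

Definition nonlinear_robin (R : realType) (S : topologicalType)
    (M : smooth_surface R S) (g : riemannian_metric M) (lambda q : R)
    (u : S -> R) : Prop :=
  forall c p, atlas M c -> cdom c p -> boundary M p ->
    normal_derivative (metric g c) (u \o cinv c) (cmap c p) + lambda * u p
    = u p `^ q.

(* Main.v *)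
(* Write h(s) = s^q - lambda s, let s0 = lambda^(1/(q-1)) be its positive zero,
   and consider P = |grad u|^2 w(u) with w(s) = (s + s0)^(-2q).  Let p be a
   maximum of P and suppose P(p) > 0.

   If grad P = 0 at p, the Bochner formula and the two-dimensional identity
   |Hess u|^2 |grad u|^2 = |grad |grad u|^2|^2 / 2 (u is harmonic) give
   Delta (log P) = 2 K + (log w)''(u) |grad u|^2 > 0, whereas the Hessian of P
   is nonpositive at p; this holds even if p lies on the boundary, because a
   nonpositive quadratic form on inward vectors is nonpositive on all vectors.
   So no Hopf lemma is needed.

   If p is on the boundary, it remains to see that grad P = 0 there.  As p is a
   maximum, P_nu >= 0; conversely the boundary condition u_nu = h(u) gives, at
   points where u has nonzero tangential derivative,
   (log P)_nu = 2 (h' - kappa + (log w)' h) <= 0,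
   since h' + (log w)' h <= 1.  Where the tangential derivative of u vanishes,
   the second tangential derivative of P is used instead, together with
   (log w)' h <= 2.

   Hence grad u = 0 everywhere and u is constant. *)

Require Import Defs.
From HB Require Import structures.
From mathcomp Require Import all_boot all_order all_algebra.
From mathcomp Require Import all_classical all_reals all_analysis.
From mathcomp Require Import ring lra.

Set Implicit Arguments.
Unset Strict Implicit.
Unset Printing Implicit Defensive.

Import Order.TTheory GRing.Theory Num.Theory.
Import numFieldNormedType.Exports.

Local Open Scope classical_set_scope.
Local Open Scope ring_scope.

(** * Functions of class C^n *)

(** One weight has to serve three estimates. Strict log-convexity, (log w)'' = 2q / (s + s0)^2 > 0,
    keeps the interior step strict even where the curvature vanishes. On the boundary, (s + s0) (h'
    + (log w)' h) equals q (s^(q-1) - lambda) (s0 - s) + lambda (q - 1) (s + s0): the exponent 2q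
    and the shift s0 make the first term a product of factors of opposite sign, and lambda (q - 1)
    <= 1 is exactly what bounds the second by s + s0. The estimate (log w)' h <= 2 comes from
    Young's inequality, whose equality case is s = s0.

    P may vanish, so no logarithm is taken: the Hessian of P itself is contracted with the cofactor
    matrix of the metric, and grad P = 0 absorbs the Christoffel terms.

    All derivatives up to the boundary are read off from local smooth extensions. The extensions
    satisfy neither the equation nor the maximality beyond the half-plane, so the second-order test
    may use only rays that stay inside it. *)

Section Cn_theory.
Variable R : realType.
Implicit Types (U V : set (plane R)) (F G : plane R -> R).

Lemma Cn_cont n U F x : Cn n U F -> U x -> {for x, continuous F}.
Proof. by case: n => [|n] [cF _] /cF. Qed.

Lemma Cn_derivable n U F i x :
  Cn n.+1 U F -> U x -> derivable F x (bvec R i).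
Proof. by move=> [_ /(_ i)[dF _]] /dF. Qed.

Lemma Cn_derive n U F i : Cn n.+1 U F -> Cn n U (fun x => 'D_(bvec R i) F x).
Proof. by move=> [_ /(_ i)[_]]. Qed.

Lemma CnS_sub n U F : Cn n.+1 U F -> Cn n U F.
Proof.
elim: n F => [F [cF _]|n IH F [cF dF]]; first by split.
by split=> // i; have [? ?] := dF i; split=> //; exact: IH.
Qed.

Lemma Cn_subset n U V F : V `<=` U -> Cn n U F -> Cn n V F.
Proof.
move=> VU; elim: n F => [F [cF _]|n IH F [cF dF]].
  by split=> // x /VU /cF.
split=> [x /VU /cF //|i]; have [dFi CFi] := dF i.
by split=> [x /VU /dFi //|]; exact: IH.
Qed.

Lemma open_near_eq U F G x : open U -> U x -> {in U, F =1 G} ->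
  \forall y \near x, F y = G y.
Proof.
move=> oU Ux FG; near=> y; apply: FG; apply/mem_set; near: y.
exact: open_nbhs_nbhs.
Unshelve. all: by end_near. Qed.

Lemma near_eq_continuous (T : topologicalType) (x : T) (f g : T -> R) :
  (\forall y \near x, f y = g y) -> {for x, continuous f} -> {for x, continuous g}.
Proof.
move=> fg cf; rewrite /prop_for /continuous_at -(nbhs_singleton fg).
by apply: cvg_trans cf; apply: near_eq_cvg.
Qed.

Lemma eq_Cn n U F G : open U -> {in U, F =1 G} -> Cn n U F -> Cn n U G.
Proof.
move=> oU; elim: n F G => [|n IH] F G FG [cF dF].
  split=> // x Ux; exact: near_eq_continuous (open_near_eq oU Ux FG) (cF x Ux).
split=> [x Ux|i].
  exact: near_eq_continuous (open_near_eq oU Ux FG) (cF x Ux).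
have [dFi CFi] := dF i; split=> [x Ux|].
  by apply: near_eq_derivable (dFi x Ux); exact: open_near_eq oU Ux FG.
apply: IH CFi => x /set_mem Ux.
by apply: near_eq_derive; exact: open_near_eq oU Ux FG.
Qed.

Lemma Cn_cst n U (a : R) : Cn n U (fun=> a).
Proof.
elim: n a => [|n IH] a; first by split=> // x _; exact: cst_continuous.
split=> [x _|i]; first exact: cst_continuous.
split=> [x _|]; first exact: derivable_cst.
by under eq_fun do rewrite derive_cst.
Qed.

Lemma CnD n U F G : open U -> Cn n U F -> Cn n U G ->
  Cn n U (fun x => F x + G x).
Proof.
move=> oU; elim: n F G => [|n IH] F G [cF dF] [cG dG].
  by split=> // x Ux; apply: continuousD; [exact: cF|exact: cG].
split=> [x Ux|i]; first by apply: continuousD; [exact: cF|exact: cG].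
have [dFi CFi] := dF i; have [dGi CGi] := dG i; split=> [x Ux|].
  by apply: derivableD; [exact: dFi|exact: dGi].
apply: eq_Cn (IH _ _ CFi CGi) => // x /set_mem Ux.
by rewrite -deriveD//; [exact: dFi|exact: dGi].
Qed.

Lemma CnM n U F G : open U -> Cn n U F -> Cn n U G ->
  Cn n U (fun x => F x * G x).
Proof.
move=> oU; elim: n F G => [|n IH] F G CF CG; have [cF dF] := CF; have [cG dG] := CG.
  by split=> // x Ux; apply: continuousM; [exact: cF|exact: cG].
split=> [x Ux|i]; first by apply: continuousM; [exact: cF|exact: cG].
have [dFi CFi] := dF i; have [dGi CGi] := dG i; split=> [x Ux|].
  by apply: derivableM; [exact: dFi|exact: dGi].
apply: (@eq_Cn _ _ (fun x => F x * 'D_(bvec R i) G x + G x * 'D_(bvec R i) F x)) => //.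
  by move=> x /set_mem Ux; rewrite [RHS]deriveM//; [exact: dFi|exact: dGi].
by apply: CnD => //; apply: IH => //; exact: CnS_sub.
Qed.

Lemma is_derive_powR F (x v : plane R) r :
  0 < F x -> derivable F x v ->
  is_derive x v (fun y => F y `^ r) (r * F x `^ (r - 1) * 'D_v F x).
Proof.
move=> Fx0 dF.
have /derivable1P dF1 := dF.
pose f := fun h : R => F (h *: v + x).
have f0 : f 0 = F x by rewrite /f scale0r add0r.
have f0_gt0 : 0 < f 0 by rewrite f0.
have dp : derivable (fun y : R => y `^ r) (f 0) 1.
  by apply: derivable_powR; rewrite in_itv/= andbT.
have e1 : (fun y : R => y `^ r) \o f = (fun h : R => F (h *: v + x) `^ r) by [].
have D0 := derive1_comp dF1 dp.
have dd : derivable ((fun y : R => y `^ r) \o f) 0 1.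
  apply/derivable1_diffP; apply: differentiable_comp; exact/derivable1_diffP.
split; first exact/derivable1P.
have key (K : plane R -> R) : 'D_v K x = derive1 (fun h : R => K (h *: v + x)) 0.
  rewrite derive1E /derive; set g1 := fun h => h^-1 *: _; set g2 := fun h => h^-1 *: _.
  suff -> : g1 = g2 by [].
  by rewrite funeqE /g1 /g2 => h /=; rewrite addr0 scale0r add0r [_%:A]mulr1.
rewrite !key D0 powR_derive1; last by rewrite in_itv/= andbT.
by rewrite scale0r add0r.
Qed.

Lemma Cn_powR n U F r : open U -> (forall x, U x -> 0 < F x) -> Cn n U F ->
  Cn n U (fun x => F x `^ r).
Proof.
move=> oU F0.
have cont x : U x -> {for x, continuous F} -> {for x, continuous (fun y => F y `^ r)}.
  move=> Ux cF; apply: (@continuous_comp _ _ _ F (fun y : R => y `^ r)) => //.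
  apply: differentiable_continuous; apply/derivable1_diffP.
  by apply: derivable_powR; rewrite in_itv/= andbT F0.
elim: n r cont => [|n IH] r cont CF; have [cF dF] := CF.
  by split=> // x Ux; apply: cont => //; exact: cF.
split=> [x Ux|i]; first by apply: cont => //; exact: cF.
have [dFi CFi] := dF i; split=> [x Ux|].
  by have [] := is_derive_powR r (F0 x Ux) (dFi x Ux).
apply: (@eq_Cn _ _ (fun x => r * F x `^ (r - 1) * 'D_(bvec R i) F x)) => //.
  by move=> x /set_mem Ux; have [_ ->] := is_derive_powR r (F0 x Ux) (dFi x Ux).
apply: CnM => //; apply: CnM => //; first exact: Cn_cst.
apply: IH; last exact: CnS_sub.
move=> x Ux cFx; apply: (@continuous_comp _ _ _ F (fun y : R => y `^ (r - 1))) => //.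
apply: differentiable_continuous; apply/derivable1_diffP.
by apply: derivable_powR; rewrite in_itv/= andbT F0.
Qed.

End Cn_theory.

(** * From partial derivatives to the total differential *)

Section plane_derivatives.
Variable R : realType.
Implicit Types (U V : set (plane R)) (F G : plane R -> R) (x y v : plane R).

Lemma sum2 (V : nmodType) (E : 'I_2 -> V) : \sum_(i < 2) E i = E 0 + E 1.
Proof.
by rewrite big_ord_recl big_ord1; congr (E _ + E _); apply/val_inj.
Qed.

Lemma bvecE (i j : 'I_2) : bvec R i 0 j = (i == j)%:R.
Proof. by rewrite mxE eqxx /= eq_sym. Qed.

Lemma plane_eqP x y : x 0 0 = y 0 0 -> x 0 1 = y 0 1 -> x = y.
Proof.
move=> e0 e1; apply/rowP => i; case: i => [[|[|//]]] Hi.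
  by rewrite (_ : Ordinal Hi = 0) //; apply/val_inj.
by rewrite (_ : Ordinal Hi = 1) //; apply/val_inj.
Qed.

Lemma plane_decomp v : v = v 0 0 *: bvec R 0 + v 0 1 *: bvec R 1.
Proof.
by apply: plane_eqP; rewrite !mxE /= ?mulr1 ?mulr0 ?addr0 ?add0r.
Qed.

Lemma normr_bvec i : `|bvec R i| <= 1.
Proof.
rewrite [leLHS]/Num.Def.normr/= mx_normrE; apply/bigmax_leP; split=> // -[a b] _.
by rewrite mxE; case: (_ && _); rewrite ?normr1 ?normr0.
Qed.

Lemma coord_le_norm v i : `|v 0 i| <= `|v|.
Proof.
rewrite [leRHS]/Num.Def.normr/= mx_normrE.
by apply/bigmax_geP; right => /=; exists (0, i).
Qed.

Definition coord_form (a b : R) (v : plane R) : R := v 0 0 * a + v 0 1 * b.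

Fact coord_form_linear a b : linear (coord_form a b).
Proof.
by move=> k u v; rewrite /coord_form !mxE /GRing.scale /=; ring.
Qed.

HB.instance Definition _ a b :=
  GRing.isLinear.Build R (plane R) R *%R (coord_form a b) (coord_form_linear a b).

Lemma continuous_coord_form a b : continuous (coord_form a b).
Proof.
move=> v; apply: (@continuousD R _ (plane R) (fun v => v 0 0 * a) (fun v => v 0 1 * b) v).
  by apply: continuousM; [exact: coord_continuous|exact: cst_continuous].
by apply: continuousM; [exact: coord_continuous|exact: cst_continuous].
Qed.

Lemma is_derive_line F x v t : derivable F (x + t *: v) v ->
  is_derive t 1 (fun s : R => F (x + s *: v)) ('D_v F (x + t *: v)).
Proof.
have key : (fun h : R => h^-1 *: (((fun s : R => F (x + s *: v)) \o shift t) (h *: 1) - F (x + t *: v))) =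
   (fun h : R => h^-1 *: ((F \o shift (x + t *: v)) (h *: v) - F (x + t *: v))).
  apply/funext => h /=; congr (_ *: (F _ - _)).
  by rewrite scalerDl addrCA [_%:A]mulr1.
by move=> dF; split; rewrite /derivable /derive ?key.
Qed.

Lemma MVT_line_pos F x v (a : R) : 0 < a ->
  (forall s : R, 0 <= s <= a -> derivable F (x + s *: v) v) ->
  exists2 c, 0 < c < a & F (x + a *: v) - F x = a * 'D_v F (x + c *: v).
Proof.
move=> a0 dF.
have D (t : R) : 0 <= t <= a -> is_derive t 1 (fun s : R => F (x + s *: v)) ('D_v F (x + t *: v)).
  by move=> /dF; exact: is_derive_line.
have [||c ca e] := @MVT R (fun s : R => F (x + s *: v)) (fun s => 'D_v F (x + s *: v)) 0 a a0.
- by move=> t; rewrite in_itv/= => /andP[t0 ta]; apply: D; rewrite !ltW.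
- apply: derivable_within_continuous => t; rewrite in_itv/= => ta.
  by have [] := D t ta.
exists c; first by move: ca; rewrite in_itv.
by move: e => /=; rewrite scale0r addr0 subr0 mulrC.
Qed.

Lemma MVT_line F x v (a : R) :
  (forall s : R, `|s| <= `|a| -> derivable F (x + s *: v) v) ->
  exists2 c, `|c| <= `|a| & F (x + a *: v) - F x = a * 'D_v F (x + c *: v).
Proof.
move=> dF; have [a0|a0|->] := ltgtP a 0.
- have dF' (s : R) : 0 <= s <= - a -> derivable F ((x + a *: v) + s *: v) v.
    move=> /andP[s0 sa]; rewrite -addrA -scalerDl; apply: dF.
    by rewrite (ltr0_norm a0) ler_norml; apply/andP; split; lra.
  have na0 : 0 < - a by rewrite oppr_gt0.
  have [c /andP[c0 ca] e] := MVT_line_pos na0 dF'.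
  exists (a + c); first by rewrite (ltr0_norm a0) ler_norml; apply/andP; split; lra.
  move: e; rewrite -!addrA -!scalerDl subrr scale0r addr0 => e.
  by rewrite -[LHS]opprB e; ring.
- have dF' (s : R) : 0 <= s <= a -> derivable F (x + s *: v) v.
    by move=> /andP[s0 sa]; apply: dF; rewrite !ger0_norm // ltW.
  have [c /andP[c0 ca] e] := MVT_line_pos a0 dF'.
  by exists c => //; rewrite !ger0_norm ?ltW.
- by exists 0; rewrite ?normr0 // scale0r addr0 subrr mul0r.
Qed.

Lemma near_plane (P : plane R -> Prop) x : (\forall y \near x, P y) ->
  exists2 d : R, 0 < d & forall y, `|y - x| < d -> P y.
Proof.
move=> /nbhs_ballP[d /= d0 dP]; exists d => // y yd; apply: dP.
by rewrite -ball_normE /= distrC.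
Qed.

(** Go from [x] to [h + x] along two sides of a coordinate rectangle: on each side the mean value
    theorem gives a partial derivative at a nearby point, and continuity of the partials costs
    [e / 2] per side. *)
Lemma Cn1_expansion U F x : open U -> U x -> Cn 1 U F ->
  forall e : R, 0 < e -> \forall h \near (0 : plane R),
  `|F (h + x) - F x - coord_form ('D_(bvec R 0) F x) ('D_(bvec R 1) F x) h| <= e * `|h|.
Proof.
move=> oU Ux CF e e0.
pose P y := [/\ U y, `|'D_(bvec R 0) F x - 'D_(bvec R 0) F y| < e / 2 &
   `|'D_(bvec R 1) F x - 'D_(bvec R 1) F y| < e / 2].
have e2 : 0 < e / 2 by rewrite divr_gt0.
have cD i : {for x, continuous (fun y => 'D_(bvec R i) F y)}.
  exact: Cn_cont (Cn_derive i CF) Ux.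
have /near_plane[d1 d10 dP1] : \forall y \near x, U y by apply: open_nbhs_nbhs.
have /cvgrPdist_lt/(_ _ e2)/near_plane[d2 d20' dP2] := cD 0.
have /cvgrPdist_lt/(_ _ e2)/near_plane[d3 d30 dP3] := cD 1.
pose d := Num.min d1 (Num.min d2 d3).
have d0 : 0 < d by rewrite !lt_min d10 d20'.
have PP y : `|y - x| < d -> P y.
  rewrite !lt_min => /and3P[y1 y2 y3]; split; [exact: dP1|exact: dP2|exact: dP3].
have d20 : 0 < d / 2 by rewrite divr_gt0.
near=> h.
have hd : `|h| < d / 2.
  near: h; apply/nbhs_ballP; exists (d / 2) => //= z.
  by rewrite -ball_normE /= sub0r normrN.
have h0 := coord_le_norm h 0; have h1 := coord_le_norm h 1.
have Pst s t : `|s| <= `|h 0 0| -> `|t| <= `|h 0 1| ->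
    P (x + s *: bvec R 0 + t *: bvec R 1).
  move=> sh th; apply: PP; rewrite addrC !addrA addNr add0r.
  apply: le_lt_trans (ler_normD _ _) _; rewrite !normrZ.
  have := normr_bvec 0; have := normr_bvec 1.
  have := normr_ge0 s; have := normr_ge0 t.
  set b0 := `|bvec R 0|; set b1 := `|bvec R 1| => t0 s0 b11 b01.
  have : `|s| * b0 <= `|s| by rewrite ler_piMr.
  have : `|t| * b1 <= `|t| by rewrite ler_piMr.
  lra.
have [s|c0 c0h E0] := @MVT_line F x (bvec R 0) (h 0 0).
  move=> sh; have := Pst s 0 sh; rewrite normr0 scale0r addr0 => /(_ (normr_ge0 _))[Us _ _].
  exact: Cn_derivable CF Us.
have [s|c1 c1h E1] := @MVT_line F (x + h 0 0 *: bvec R 0) (bvec R 1) (h 0 1).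
  move=> sh; have [Us _ _] := Pst (h 0 0) s (lexx _) sh.
  exact: Cn_derivable CF Us.
have -> : F (h + x) = F (x + h 0 0 *: bvec R 0 + h 0 1 *: bvec R 1).
  by rewrite addrC -addrA -plane_decomp.
have -> : F (x + h 0 0 *: bvec R 0 + h 0 1 *: bvec R 1) - F x -
    coord_form ('D_(bvec R 0) F x) ('D_(bvec R 1) F x) h =
  h 0 0 * ('D_(bvec R 0) F (x + c0 *: bvec R 0) - 'D_(bvec R 0) F x) +
  h 0 1 * ('D_(bvec R 1) F (x + h 0 0 *: bvec R 0 + c1 *: bvec R 1)
           - 'D_(bvec R 1) F x).
  by rewrite !mulrBr -E0 -E1 /coord_form; ring.
have [_ A0 _] : P (x + c0 *: bvec R 0).
  have := Pst c0 0 c0h; rewrite normr0 scale0r addr0; apply.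
  exact: normr_ge0.
have [_ _ A1] := Pst _ _ (lexx _) c1h.
apply: le_trans (ler_normD _ _) _; rewrite !normrM.
rewrite (splitr e) mulrDl; apply: lerD.
  by rewrite mulrC; apply: ler_pM => //; rewrite distrC ltW.
by rewrite mulrC; apply: ler_pM => //; rewrite distrC ltW.
Unshelve. all: by end_near. Qed.

Lemma Cn1_diff U F x : open U -> U x -> Cn 1 U F ->
  differentiable F x /\
  'd F x = coord_form ('D_(bvec R 0) F x) ('D_(bvec R 1) F x) :> (_ -> _).
Proof.
move=> oU Ux CF; set L := coord_form _ _.
have cL : continuous L by exact: continuous_coord_form.
have E : F \o shift x = cst (F x) + (L : plane R -> R^o) +o_ (0 : plane R) id.
  apply/eqaddoP => _/posnumP[e].
  have := Cn1_expansion oU Ux CF [gt0 of e%:num].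
  apply: filterS => h hE; apply: le_trans hE; rewrite le_eqVlt.
  apply/orP; left; apply/eqP; congr `|_|.
  change (F (h + x) - (F x + L h) = F (h + x) - F x - L h).
  by rewrite opprD addrA.
have dE := @diff_unique R (plane R) R^o F L x cL E.
split=> //; apply/diff_locallyP; rewrite dE; split; first exact: cL.
exact: E.
Qed.

Lemma Cn1_derive U F x v : open U -> U x -> Cn 1 U F ->
  is_derive x v F (v 0 0 * 'D_(bvec R 0) F x + v 0 1 * 'D_(bvec R 1) F x).
Proof.
move=> oU Ux CF; have [dF dE] := Cn1_diff oU Ux CF.
by split; [exact: diff_derivable|rewrite deriveE// dE].
Qed.

End plane_derivatives.

(** * Symmetry of second derivatives and the second-order test along a ray *)

Section second_derivatives.
Variable R : realType.
Implicit Types (U V : set (plane R)) (F G : plane R -> R) (x y v : plane R).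

Lemma normr_bvec2 (i j : 'I_2) (s t : R) :
  `|s *: bvec R i + t *: bvec R j| <= `|s| + `|t|.
Proof.
apply: le_trans (ler_normD _ _) _; rewrite !normrZ.
by apply: lerD; rewrite ler_piMr ?normr_bvec.
Qed.

Lemma derivable_shift F x v (w : plane R) :
  derivable F (x + w) v -> is_derive x v (fun y => F (y + w)) ('D_v F (x + w)).
Proof.
move=> dF.
have key : (fun h : R => h^-1 *: (((fun y => F (y + w)) \o shift x) (h *: v) - F (x + w))) =
   (fun h : R => h^-1 *: ((F \o shift (x + w)) (h *: v) - F (x + w))).
  by apply/funext => h /=; congr (_ *: (F _ - _)); rewrite addrA.
by split; rewrite /derivable /derive ?key.
Qed.

(** Two mean values: first for the increment [G] of [F] in the direction [j], moving along [i], then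
    for the [i]-th partial derivative, moving along [j]. *)
Lemma double_difference U F x (d h : R) (i j : 'I_2) : Cn 2 U F ->
  (forall y, `|y - x| < d -> U y) -> 0 < h -> h + h < d ->
  exists2 y, `|y - x| < d &
    F (x + h *: bvec R i + h *: bvec R j) - F (x + h *: bvec R i)
    - F (x + h *: bvec R j) + F x = h ^+ 2 * 'D_(bvec R j) ('D_(bvec R i) F) y.
Proof.
move=> CF dU h0 hd.
have CF1 := CnS_sub CF.
have Ust (s t : R) : 0 <= s <= h -> 0 <= t <= h -> `|(x + s *: bvec R i + t *: bvec R j) - x| < d.
  move=> /andP[s0 sh] /andP[t0 th].
  rewrite addrC !addrA addNr add0r.
  apply: le_lt_trans (normr_bvec2 _ _ _ _) _; rewrite !ger0_norm//; lra.
have hh : 0 <= h <= h by rewrite ltW /=.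
have Us (s : R) : 0 <= s <= h -> `|(x + s *: bvec R i) - x| < d.
  by move=> sh; have := @Ust s 0 sh; rewrite scale0r addr0; apply; rewrite lexx ltW.
pose G y := F (y + h *: bvec R j) - F y.
have dG (s : R) : 0 <= s <= h -> is_derive (x + s *: bvec R i) (bvec R i) G
   ('D_(bvec R i) F (x + s *: bvec R i + h *: bvec R j) - 'D_(bvec R i) F (x + s *: bvec R i)).
  move=> sh; apply: is_deriveB.
    by apply: derivable_shift; apply: Cn_derivable CF1 _; apply: dU; apply: Ust.
  by apply: derivableP; apply: Cn_derivable CF1 _; apply: dU; apply: Us.
have [s sh|c /andP[c0 ch] E] := @MVT_line_pos R G x (bvec R i) h h0.
  by have [] := dG s sh.
have c0h : 0 <= c <= h by rewrite !ltW.
have [_ E1] := dG c c0h.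
have [s sh|c' /andP[c'0 c'h] E'] :=
    @MVT_line_pos R (fun y => 'D_(bvec R i) F y) (x + c *: bvec R i) (bvec R j) h h0.
  by apply: Cn_derivable (Cn_derive i CF) _; apply: dU; apply: Ust.
exists (x + c *: bvec R i + c' *: bvec R j); first by apply: Ust; rewrite // !ltW.
rewrite expr2 -mulrA -E' -E1 -E /G; ring.
Qed.

Fact quotients_close (p a b c A B A0 B0 h e : R) : h != 0 ->
  p - a - b + c = h ^+ 2 * A -> p - b - a + c = h ^+ 2 * B ->
  `|A0 - A| < e / 2 -> `|B0 - B| < e / 2 -> `|A0 - B0| <= e.
Proof.
move=> h0 EA EB; have -> : A = B.
  have h2 : h ^+ 2 != 0 by rewrite expf_neq0.
  by apply: (mulfI h2); rewrite -EA -EB; ring.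
rewrite !ltr_norml !ler_norml => /andP[? ?] /andP[? ?]; apply/andP; split; lra.
Qed.

(** The double difference is symmetric in [i] and [j], so the two mixed derivatives agree at points
    [y] and [z] close to [x]; continuity brings both to [x]. *)
Lemma Cn2_schwarz U F x (i j : 'I_2) : open U -> U x -> Cn 2 U F ->
  'D_(bvec R j) ('D_(bvec R i) F) x = 'D_(bvec R i) ('D_(bvec R j) F) x.
Proof.
move=> oU Ux CF; apply/eqP; rewrite -subr_eq0 -normr_le0; apply/ler_addgt0Pl => e e0.
rewrite addr0.
have cD a b : {for x, continuous (fun y => 'D_(bvec R a) ('D_(bvec R b) F) y)}.
  exact: Cn_cont (Cn_derive a (Cn_derive b CF)) Ux.
have e2 : 0 < e / 2 by rewrite divr_gt0.
have /near_plane[d1 d10 dP1] : \forall y \near x, U y by apply: open_nbhs_nbhs.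
have /cvgrPdist_lt/(_ _ e2)/near_plane[d2 d20 dP2] := cD j i.
have /cvgrPdist_lt/(_ _ e2)/near_plane[d3 d30 dP3] := cD i j.
pose d := Num.min d1 (Num.min d2 d3).
have d0 : 0 < d by rewrite !lt_min d10 d20.
have dP y : `|y - x| < d -> [/\ U y,
   `|'D_(bvec R j) ('D_(bvec R i) F) x - 'D_(bvec R j) ('D_(bvec R i) F) y| < e / 2 &
   `|'D_(bvec R i) ('D_(bvec R j) F) x - 'D_(bvec R i) ('D_(bvec R j) F) y| < e / 2].
  rewrite !lt_min => /and3P[y1 y2 y3]; split; [exact: dP1|exact: dP2|exact: dP3].
have dU y : `|y - x| < d -> U y by move=> /dP[].
have h0 : 0 < d / 3 by rewrite divr_gt0.
have hd : d / 3 + d / 3 < d by lra.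
have [y yd Ey] := double_difference i j CF dU h0 hd.
have [z zd Ez] := double_difference j i CF dU h0 hd.
rewrite [x + _ + _]addrAC in Ez.
have [_ A1 _] := dP y yd; have [_ _ A2] := dP z zd.
exact: quotients_close (lt0r_neq0 h0) Ey Ez A1 A2.
Qed.

Lemma derive_gt0_right F x v : derivable F x v -> 0 < 'D_v F x ->
  exists2 d : R, 0 < d & forall t, 0 < t < d -> F x < F (x + t *: v).
Proof.
move=> dF D0.
have /cvgrPdist_lt/(_ _ D0) : (fun h : R => h^-1 *: ((F \o shift x) (h *: v) - F x)) @ 0^' --> 'D_v F x by [].
rewrite near_withinE => /nbhs_ballP[d /= d0 dP]; exists d => // t /andP[t0 td].
have := dP t; rewrite /ball /= sub0r normrN gtr0_norm// => /(_ td).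
rewrite gt_eqF// => /(_ isT).
rewrite ltr_norml => /andP[_]; rewrite ltrBlDr -ltrBlDl subrr.
by rewrite /GRing.scale/= pmulr_rgt0 ?invr_gt0// subr_gt0 addrC.
Qed.

Fact quadratic_expansion (a b p q r s : R) :
  a * (a * p + b * q) + b * (a * r + b * s) =
  a ^+ 2 * p + a * b * (r + q) + b ^+ 2 * s.
Proof. ring. Qed.

(** A positive slope at [x] would make [F] larger just after [x]. If the slope [D1 x] vanishes but
    the second derivative is positive, then [D1] is positive just after [x], and the mean value
    theorem again makes [F] larger. Only one side of the line is used. *)
Lemma max_half_line U F x v (e : R) : open U -> U x -> Cn 2 U F -> 0 < e ->
  (forall t, 0 < t < e -> F (x + t *: v) <= F x) ->
  let D1 y := v 0 0 * 'D_(bvec R 0) F y + v 0 1 * 'D_(bvec R 1) F y in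
  D1 x <= 0 /\
  (D1 x = 0 ->
   v 0 0 ^+ 2 * 'D_(bvec R 0) ('D_(bvec R 0) F) x
   + v 0 0 * v 0 1 * ('D_(bvec R 0) ('D_(bvec R 1) F) x + 'D_(bvec R 1) ('D_(bvec R 0) F) x)
   + v 0 1 ^+ 2 * 'D_(bvec R 1) ('D_(bvec R 1) F) x <= 0).
Proof.
move=> oU Ux CF e0 Fmax D1.
have CF1 := CnS_sub CF.
have dF y : U y -> is_derive y v F (D1 y) by move=> Uy; exact: Cn1_derive oU Uy CF1.
have contra (d : R) : 0 < d -> (forall t, 0 < t < d -> F x < F (x + t *: v)) -> False.
  move=> d0 dP; pose t := Num.min d e / 2.
  have m0 : 0 < Num.min d e by rewrite lt_min d0.
  have t0 : 0 < t by rewrite divr_gt0.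
  have tm : t < Num.min d e by rewrite /t; lra.
  move: tm; rewrite lt_min => /andP[td te].
  have := dP t; rewrite t0 td => /(_ isT).
  by rewrite ltNge Fmax// t0.
split.
  rewrite leNgt; apply/negP => D0.
  have [dFx E] := dF x Ux.
  have [|d d0 dP] := derive_gt0_right dFx; first by rewrite E.
  exact: contra d0 dP.
move=> D1x; rewrite leNgt; apply/negP => DD0.
have dD1 : is_derive x v D1 (v 0 0 ^+ 2 * 'D_(bvec R 0) ('D_(bvec R 0) F) x
   + v 0 0 * v 0 1 * ('D_(bvec R 0) ('D_(bvec R 1) F) x + 'D_(bvec R 1) ('D_(bvec R 0) F) x)
   + v 0 1 ^+ 2 * 'D_(bvec R 1) ('D_(bvec R 1) F) x).
  have A i := Cn1_derive v oU Ux (Cn_derive i CF).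
  have E := is_deriveD (is_deriveZ (v 0 0) (A 0)) (is_deriveZ (v 0 1) (A 1)).
  apply: (is_derive_eq E).
  exact: quadratic_expansion.
have [dD1x E] := dD1.
have [|d d0 dP] := derive_gt0_right dD1x; first by rewrite E.
have /near_plane[r r0 rP] : \forall y \near x, U y by apply: open_nbhs_nbhs.
have n0 : 0 < `|v| + 1 by rewrite ltr_wpDl.
pose d' := Num.min d (r / (`|v| + 1)).
have d'0 : 0 < d' by rewrite lt_min d0 divr_gt0.
apply: (contra d') => // t /andP[t0]; rewrite lt_min => /andP[td tr].
have Us (s : R) : 0 <= s <= t -> U (x + s *: v).
  move=> /andP[s0 st]; apply: rP; rewrite addrC addrA addNr add0r normrZ ger0_norm//.
  apply: le_lt_trans (_ : s * (`|v| + 1) < r).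
    by rewrite ler_wpM2l// lerDl.
  by rewrite -ltr_pdivlMr//; apply: le_lt_trans tr.
have [s st|c /andP[c0 ct] Ec] := @MVT_line_pos R F x v t t0.
  by have [] := dF _ (Us s st).
rewrite -subr_gt0 Ec pmulr_rgt0//.
have [|_ ->] := dF (x + c *: v); first by apply: Us; rewrite !ltW.
by rewrite -D1x; apply: dP; rewrite c0 (lt_trans ct).
Qed.

End second_derivatives.

(** * Calculus up to the boundary of the half-plane *)

Section pderiv_base.
Variable R : realType.
Implicit Types (D U V : set (plane R)) (f g F G : plane R -> R) (x y v : plane R).

Let pfilter (i : 'I_2) x := within [set h : R | half_plane (x + h *: bvec R i)] (0 : R)^'.

(** Small positive [h] always stay in the half-plane, because the second coordinate of [bvec R i] is
    nonnegative. Properness makes the limit in [pderiv] unique. *)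
Lemma proper_pderiv (i : 'I_2) x : half_plane x -> ProperFilter (pfilter i x).
Proof.
move=> Hx; apply: Build_ProperFilter_ex => [P HP].
have : nbhs (0 : R) [set h | h != 0 -> half_plane (x + h *: bvec R i) -> P h] := HP.
move=> /nbhs_ballP[d /= d0 dP].
exists (d / 2).
apply: (dP (d / 2)); rewrite /ball /=.
- by rewrite sub0r normrN gtr0_norm ?divr_gt0//; lra.
- by rewrite gt_eqF// divr_gt0.
rewrite /half_plane /= !mxE; apply: addr_ge0 => //; apply: mulr_ge0 => //.
  by rewrite ltW// divr_gt0.
Qed.

(** The quotient of [F] converges along all punctured neighbourhoods, hence along the finer filter
    of [pderiv], on which it coincides with the quotient of [f]. *)
Lemma pderiv_ext V F f i x : open V -> V x -> half_plane x ->
  derivable F x (bvec R i) ->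
  (forall y, V y -> half_plane y -> F y = f y) ->
  pderiv i f x = 'D_(bvec R i) F x.
Proof.
move=> oV Vx Hx dFx Ff; have PF := proper_pderiv i Hx.
apply: cvg_lim => //.
have dF : (fun h : R => h^-1 *: ((F \o shift x) (h *: bvec R i) - F x)) @ 0^' -->
    'D_(bvec R i) F x := dFx.
have dF' : (fun h : R => h^-1 *: ((F \o shift x) (h *: bvec R i) - F x)) @ pfilter i x -->
    'D_(bvec R i) F x.
  by apply: cvg_trans dF; apply: cvg_app; exact: cvg_within.
apply: cvg_trans dF'; apply: near_eq_cvg.
suff : nbhs (0 : R) [set h | h != 0 -> half_plane (x + h *: bvec R i) ->
  h^-1 *: ((F \o shift x) (h *: bvec R i) - F x) =
  h^-1 * (f (x + h *: bvec R i) - f x)] by [].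
have [d d0 dP] : exists2 d : R, 0 < d & forall y, `|y - x| < d -> V y.
  by apply: near_plane; exact: open_nbhs_nbhs.
apply/nbhs_ballP; exists d => //= h; rewrite /ball /= sub0r normrN => hd h0 Hh.
rewrite /= (Ff x)// [_ + x]addrC Ff//.
apply: dP; rewrite addrAC subrr add0r normrZ.
by apply: le_lt_trans hd; rewrite ler_piMr// normr_bvec.
Qed.

Lemma pderivE V F f i x : open V -> V x -> half_plane x -> Cn 1 V F ->
  (forall y, V y -> half_plane y -> F y = f y) ->
  pderiv i f x = 'D_(bvec R i) F x.
Proof. by move=> oV Vx Hx CF; exact: (pderiv_ext oV Vx Hx (Cn_derivable CF Vx)). Qed.

Lemma pderiv_near_eq f g i x : half_plane x -> f x = g x ->
  (exists2 d : R, 0 < d & forall h : R, `|h| < d -> half_plane (x + h *: bvec R i) ->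
     f (x + h *: bvec R i) = g (x + h *: bvec R i)) ->
  pderiv i f x = pderiv i g x.
Proof.
move=> Hx fgx [d d0 dP]; rewrite /pderiv fgx; congr (lim _).
have key : \forall h \near pfilter i x,
    h^-1 * (f (x + h *: bvec R i) - g x) = h^-1 * (g (x + h *: bvec R i) - g x).
  suff : nbhs (0 : R) [set h | h != 0 -> half_plane (x + h *: bvec R i) ->
    h^-1 * (f (x + h *: bvec R i) - g x) =
    h^-1 * (g (x + h *: bvec R i) - g x)] by [].
  apply/nbhs_ballP; exists d => //= h; rewrite /ball /= sub0r normrN => hd h0 Hh.
  by rewrite dP.
have PF := proper_pderiv i Hx.
rewrite eqEsubset; split; apply: near_eq_cvg => //.
by apply: filterS key => h ->.
Qed.

End pderiv_base.

(** * Functions smooth up to the boundary *)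

Section smooth_theory.
Variables (R : realType) (U0 D : set (plane R)).
Hypothesis U0_open : open U0.
Hypothesis DE : D = U0 `&` @half_plane R.
Implicit Types (f g F G : plane R -> R) (x y v : plane R) (V : set (plane R)).

Lemma smooth_ext f x : smooth_on D f -> D x ->
  exists V F, [/\ open V, V x, forall n, Cn n V F,
    forall y, V y -> half_plane y -> D y &
    forall y, V y -> half_plane y -> F y = f y].
Proof.
move=> sf Dx; have [V [F [oV Vx CF Ff]]] := sf x Dx.
have HD y : U0 y -> half_plane y -> D y by rewrite DE.
exists (V `&` U0), F; split.
- exact: openI.
- by split=> //; move: Dx; rewrite DE => -[].
- by move=> n; apply: Cn_subset (CF n) => y [].
- by move=> y [_ Uy]; exact: HD.
- by move=> y [Vy Uy] Hy; apply: Ff => //; exact: HD.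
Qed.

Lemma D_half x : D x -> half_plane x.
Proof. by rewrite DE => -[]. Qed.

Lemma D_near x : D x -> exists2 d : R, 0 < d &
  forall y, `|y - x| < d -> half_plane y -> D y.
Proof.
rewrite DE => -[Ux _].
have [d d0 dP] : exists2 d : R, 0 < d & forall y, `|y - x| < d -> U0 y.
  by apply: near_plane; exact: open_nbhs_nbhs.
by exists d => // y /dP.
Qed.

Lemma smooth_eq f g : {in D, f =1 g} -> smooth_on D f -> smooth_on D g.
Proof.
move=> fg sf x Dx; have [V [F [oV Vx CF Ff]]] := sf x Dx.
by exists V, F; split=> // y Vy Dy; rewrite Ff// fg//; exact/mem_set.
Qed.

Lemma smooth_cst (a : R) : smooth_on D (fun=> a).
Proof.
move=> x _; exists setT, (fun=> a); split=> //; first exact: openT.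
by move=> n; exact: Cn_cst.
Qed.

Lemma smoothD f g : smooth_on D f -> smooth_on D g -> smooth_on D (fun x => f x + g x).
Proof.
move=> sf sg x Dx; have [V [F [oV Vx CF Ff]]] := sf x Dx.
have [W [G [oW Wx CG Gg]]] := sg x Dx.
exists (V `&` W), (fun x => F x + G x); split => //; first exact: openI.
  move=> n; apply: CnD; first exact: openI.
    by apply: Cn_subset (CF n) => y [].
  by apply: Cn_subset (CG n) => y [].
by move=> y [Vy Wy] Dy; rewrite Ff// Gg.
Qed.

Lemma smoothM f g : smooth_on D f -> smooth_on D g -> smooth_on D (fun x => f x * g x).
Proof.
move=> sf sg x Dx; have [V [F [oV Vx CF Ff]]] := sf x Dx.
have [W [G [oW Wx CG Gg]]] := sg x Dx.
exists (V `&` W), (fun x => F x * G x); split => //; first exact: openI.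
  move=> n; apply: CnM; first exact: openI.
    by apply: Cn_subset (CF n) => y [].
  by apply: Cn_subset (CG n) => y [].
by move=> y [Vy Wy] Dy; rewrite Ff// Gg.
Qed.

Lemma smoothN f : smooth_on D f -> smooth_on D (fun x => - f x).
Proof.
move=> sf; apply: (@smooth_eq (fun x => -1 * f x)) => [x _|]; first by rewrite mulN1r.
by apply: smoothM => //; exact: smooth_cst.
Qed.

Lemma smoothB f g : smooth_on D f -> smooth_on D g -> smooth_on D (fun x => f x - g x).
Proof. by move=> sf sg; apply: smoothD => //; exact: smoothN. Qed.

Lemma open_pos V F : open V -> (forall y, V y -> {for y, continuous F}) ->
  open (V `&` [set y | 0 < F y]).
Proof.
move=> oV cF; rewrite openE => y [Vy Fy]; rewrite /interior.
have /cvgrPdist_lt/(_ _ Fy) := cF y Vy.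
move=> H; near=> z; split; near: z; first exact: open_nbhs_nbhs.
apply: filterS H => z /=; rewrite ltr_norml => /andP[_].
by rewrite ltrBlDr -ltrBlDl subrr.
Unshelve. all: by end_near. Qed.

(** A local extension of [f] need not be positive, so its domain is cut down to the open set where
    it is. *)
Lemma smooth_powR f r : {in D, forall x, 0 < f x} -> smooth_on D f ->
  smooth_on D (fun x => f x `^ r).
Proof.
move=> f0 sf x Dx; have [V [F [oV Vx CF Ff]]] := sf x Dx.
have oW : open (V `&` [set y | 0 < F y]).
  by apply: open_pos => // y; exact: Cn_cont (CF 0%N).
exists (V `&` [set y | 0 < F y]), (fun x => F x `^ r); split => //.
- by split=> //=; rewrite Ff// f0//; exact/mem_set.
- move=> n; apply: Cn_powR => //; first by move=> y [].
  by apply: Cn_subset (CF n) => y [].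
by move=> y [Vy _] Dy; rewrite Ff.
Qed.

Lemma smooth_pderiv i f : smooth_on D f -> smooth_on D (pderiv i f).
Proof.
move=> sf x Dx; have [V [F [oV Vx CF VD Ff]]] := smooth_ext sf Dx.
exists V, ('D_(bvec R i) F); split=> // [n|y Vy /D_half Hy].
  exact: Cn_derive (CF n.+1).
by symmetry; exact: pderivE oV Vy Hy (CF 1%N) Ff.
Qed.

Lemma pderiv_eq f g i x : {in D, f =1 g} -> D x -> pderiv i f x = pderiv i g x.
Proof.
move=> fg Dx; apply: pderiv_near_eq; first exact: D_half.
  by rewrite fg//; exact/mem_set.
have [d d0 dP] := D_near Dx; exists d => // h hd Hh.
apply: fg; apply/mem_set; apply: dP => //.
rewrite addrAC subrr add0r normrZ.
by apply: le_lt_trans hd; rewrite ler_piMr// normr_bvec.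
Qed.

(** The direction [bvec R 0] does not leave the line, so identities known only on the boundary, such
    as the Robin condition, may be differentiated tangentially. *)
Lemma pderiv0_eq_line f g x : (forall y, D y -> y 0 1 = 0 -> f y = g y) ->
  D x -> x 0 1 = 0 -> pderiv 0 f x = pderiv 0 g x.
Proof.
move=> fg Dx x1; apply: pderiv_near_eq; first exact: D_half.
  exact: fg.
have [d d0 dP] := D_near Dx; exists d => // h hd Hh.
apply: fg; last by rewrite !mxE x1 /= mulr0 addr0.
apply: dP => //; rewrite addrAC subrr add0r normrZ.
by apply: le_lt_trans hd; rewrite ler_piMr// normr_bvec.
Qed.

Lemma pderiv_cst (a : R) i x : D x -> pderiv i (fun=> a) x = 0.
Proof.
move=> Dx; rewrite (@pderivE _ setT (fun=> a))//; first exact: derive_cst.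
- exact: openT.
- exact: D_half.
- exact: Cn_cst.
Qed.

Lemma is_derive_coord (y : plane R) i j :
  is_derive y (bvec R i) (fun z : plane R => z 0 j : R) ((i == j)%:R).
Proof.
have K : (fun h : R => h^-1 *: (((fun z : plane R => z 0 j : R) \o shift y) (h *: bvec R i) - y 0 j)) @ 0^' --> ((i == j)%:R : R).
  apply: cvg_near_cst.
  suff : nbhs (0 : R) [set h : R | h != 0 -> h^-1 *: (((fun z : plane R => z 0 j : R) \o shift y) (h *: bvec R i) - y 0 j) = (i == j)%:R] by [].
  near=> h => h0 /=.
  by rewrite !mxE /= addrK /GRing.scale/= mulrA mulVf// mul1r eq_sym.
by split; [apply/cvg_ex; exists (i == j)%:R|apply: cvg_lim].
Unshelve. all: by end_near. Qed.

Lemma pderiv_coord i j x : D x -> pderiv i (fun y => y 0 j) x = (i == j)%:R.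
Proof.
move=> /D_half Hx.
rewrite (@pderivE _ setT (fun y => y 0 j))//.
- by have [_ ->] := is_derive_coord x i j.
- exact: openT.
split=> [y _|k]; first exact: coord_continuous.
split=> [y _|]; first by have [] := is_derive_coord y k j.
rewrite (_ : (fun y => _) = fun=> (k == j)%:R); first exact: (Cn_cst 0).
by apply/funext => y; have [_ ->] := is_derive_coord y k j.
Qed.

Lemma pderivD f g i x : smooth_on D f -> smooth_on D g -> D x ->
  pderiv i (fun y => f y + g y) x = pderiv i f x + pderiv i g x.
Proof.
move=> sf sg Dx; have Hx := D_half Dx.
have [V [F [oV Vx CF VD Ff]]] := smooth_ext sf Dx.
have [W [G [oW Wx CG WD Gg]]] := smooth_ext sg Dx.
rewrite (pderivE i oV Vx Hx (CF 1%N) Ff) (pderivE i oW Wx Hx (CG 1%N) Gg).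
have oVW := openI oV oW.
rewrite (@pderivE _ (V `&` W) (fun y => F y + G y))//.
- apply: deriveD; first exact: Cn_derivable (CF 1%N) Vx.
  exact: Cn_derivable (CG 1%N) Wx.
- apply: CnD => //; first by apply: Cn_subset (CF 1%N) => y [].
  by apply: Cn_subset (CG 1%N) => y [].
by move=> y [Vy Wy] Hy; rewrite Ff// Gg.
Qed.

Lemma pderivM f g i x : smooth_on D f -> smooth_on D g -> D x ->
  pderiv i (fun y => f y * g y) x = pderiv i f x * g x + f x * pderiv i g x.
Proof.
move=> sf sg Dx; have Hx := D_half Dx.
have [V [F [oV Vx CF VD Ff]]] := smooth_ext sf Dx.
have [W [G [oW Wx CG WD Gg]]] := smooth_ext sg Dx.
rewrite (pderivE i oV Vx Hx (CF 1%N) Ff) (pderivE i oW Wx Hx (CG 1%N) Gg).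
have oVW := openI oV oW.
rewrite (@pderivE _ (V `&` W) (fun y => F y * G y))//.
- rewrite [LHS]deriveM; last 2 first.
  + exact: Cn_derivable (CF 1%N) Vx.
  + exact: Cn_derivable (CG 1%N) Wx.
  by rewrite (Ff _ Vx Hx) (Gg _ Wx Hx) addrC /GRing.scale /= [g x * _]mulrC.
- apply: CnM => //; first by apply: Cn_subset (CF 1%N) => y [].
  by apply: Cn_subset (CG 1%N) => y [].
by move=> y [Vy Wy] Hy; rewrite Ff// Gg.
Qed.

Lemma pderivN f i x : smooth_on D f -> D x ->
  pderiv i (fun y => - f y) x = - pderiv i f x.
Proof.
move=> sf Dx; rewrite (@pderiv_eq _ (fun y => -1 * f y))//; last first.
  by move=> y _; rewrite mulN1r.
rewrite pderivM//; last exact: smooth_cst.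
by rewrite pderiv_cst// mul0r add0r mulN1r.
Qed.

Lemma pderivB f g i x : smooth_on D f -> smooth_on D g -> D x ->
  pderiv i (fun y => f y - g y) x = pderiv i f x - pderiv i g x.
Proof.
by move=> sf sg Dx; rewrite pderivD ?pderivN//; exact: smoothN.
Qed.

Lemma pderivZ (a : R) f i x : smooth_on D f -> D x ->
  pderiv i (fun y => a * f y) x = a * pderiv i f x.
Proof.
move=> sf Dx; rewrite pderivM//; last exact: smooth_cst.
by rewrite pderiv_cst// mul0r add0r.
Qed.

Lemma pderiv_powR f r i x : {in D, forall x, 0 < f x} -> smooth_on D f -> D x ->
  pderiv i (fun y => f y `^ r) x = r * f x `^ (r - 1) * pderiv i f x.
Proof.
move=> f0 sf Dx; have Hx := D_half Dx.
have [V [F [oV Vx CF VD Ff]]] := smooth_ext sf Dx.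
have FV y : V y -> half_plane y -> 0 < F y.
  by move=> Vy Hy; rewrite Ff// f0//; apply/mem_set; exact: VD.
rewrite (pderivE i oV Vx Hx (CF 1%N) Ff).
rewrite (@pderivE _ (V `&` [set y | 0 < F y]) (fun y => F y `^ r))//.
- have [_ ->] := is_derive_powR r (FV x Vx Hx) (Cn_derivable (i := i) (CF 1%N) Vx).
  by rewrite Ff.
- by apply: open_pos => // y; exact: Cn_cont (CF 0%N).
- by split=> //; exact: FV.
- apply: Cn_powR => //; last by apply: Cn_subset (CF 1%N) => y [].
    by apply: open_pos => // y; exact: Cn_cont (CF 0%N).
  by move=> y [].
by move=> y [Vy _] Hy; rewrite Ff.
Qed.

Lemma pderivC f i j x : smooth_on D f -> D x ->
  pderiv i (pderiv j f) x = pderiv j (pderiv i f) x.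
Proof.
move=> sf Dx; have Hx := D_half Dx.
have [V [F [oV Vx CF VD Ff]]] := smooth_ext sf Dx.
have E k y : V y -> half_plane y -> 'D_(bvec R k) F y = pderiv k f y.
  by move=> Vy Hy; symmetry; exact: pderivE oV Vy Hy (CF 1%N) Ff.
rewrite (pderivE i oV Vx Hx (Cn_derive j (CF 2%N)) (E j)).
rewrite (pderivE j oV Vx Hx (Cn_derive i (CF 2%N)) (E i)).
exact: Cn2_schwarz oV Vx (CF 2%N).
Qed.

(** The condition on [v] keeps a short piece of the ray inside the half-plane, where the extension
    agrees with [f] and inherits the maximum. *)
Lemma pderiv_max f x v : smooth_on D f -> D x -> (forall y, D y -> f y <= f x) ->
  0 <= v 0 1 \/ 0 < x 0 1 ->
  v 0 0 * pderiv 0 f x + v 0 1 * pderiv 1 f x <= 0 /\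
  (v 0 0 * pderiv 0 f x + v 0 1 * pderiv 1 f x = 0 ->
   v 0 0 ^+ 2 * pderiv 0 (pderiv 0 f) x
   + v 0 0 * v 0 1 * (pderiv 0 (pderiv 1 f) x + pderiv 1 (pderiv 0 f) x)
   + v 0 1 ^+ 2 * pderiv 1 (pderiv 1 f) x <= 0).
Proof.
move=> sf Dx fmax Hv; have Hx := D_half Dx.
have [V [F [oV Vx CF VD Ff]]] := smooth_ext sf Dx.
have E k y : V y -> half_plane y -> 'D_(bvec R k) F y = pderiv k f y.
  by move=> Vy Hy; symmetry; exact: pderivE oV Vy Hy (CF 1%N) Ff.
have E2 i j : 'D_(bvec R i) ('D_(bvec R j) F) x = pderiv i (pderiv j f) x.
  by rewrite (pderivE i oV Vx Hx (Cn_derive j (CF 2%N)) (E j)).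
have [d d0 dP] : exists2 d : R, 0 < d & forall y, `|y - x| < d -> V y.
  by apply: near_plane; exact: open_nbhs_nbhs.
have n0 : 0 < `|v| + 1 by rewrite ltr_wpDl.
have Vt t : 0 < t < d / (`|v| + 1) -> V (x + t *: v).
  move=> /andP[t0 tr].
  apply: dP; rewrite addrAC subrr add0r normrZ gtr0_norm//.
  apply: le_lt_trans (_ : t * (`|v| + 1) < d).
    by rewrite ler_wpM2l ?lerDl ?ltW.
  by rewrite -ltr_pdivlMr.
have [e e0 He] : exists2 e : R, 0 < e & forall t, 0 < t < e -> half_plane (x + t *: v).
  case: Hv => [v1|x1].
    exists 1 => // t /andP[t0 _]; rewrite /half_plane /= !mxE.
    by apply: addr_ge0 => //; apply: mulr_ge0 => //; exact: ltW.
  exists (x 0 1 / (`|v| + 1)); first by rewrite divr_gt0.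
  move=> t /andP[t0]; rewrite ltr_pdivlMr// => te; rewrite /half_plane /= !mxE.
  have := coord_le_norm v 1; rewrite ler_norml => /andP[v1 _].
  have : t * (- `|v|) <= t * v 0 1 by rewrite ler_wpM2l// ltW.
  lra.
have [||H1 H2] := @max_half_line R V F x v (Num.min (d / (`|v| + 1)) e) oV Vx (CF 2%N).
- by rewrite lt_min e0 divr_gt0.
- move=> t /andP[t0]; rewrite lt_min => /andP[td te].
  have Vy := Vt t (introT andP (conj t0 td)).
  have Hy := He t (introT andP (conj t0 te)).
  by rewrite !Ff//; apply: fmax; exact: VD.
rewrite !E2 !(E _ _ Vx Hx) in H1 H2; split; [exact: H1|exact: H2].
Qed.

End smooth_theory.

(** * Local Riemannian geometry *)

Lemma ord2P (P : 'I_2 -> Prop) : P 0 -> P 1 -> forall i, P i.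
Proof.
move=> P0 P1 i; case: i => [[|[|//]]] Hi.
  by rewrite (_ : Ordinal Hi = 0)//; apply/val_inj.
by rewrite (_ : Ordinal Hi = 1)//; apply/val_inj.
Qed.

Section bilinear.
Variable R : realType.
Implicit Types (g : plane R -> 'M[R]_2) (x v w : plane R).

Lemma innerE g x v w : inner g x v w =
  (v 0 0 * g x 0 0 + v 0 1 * g x 1 0) * w 0 0 +
  (v 0 0 * g x 0 1 + v 0 1 * g x 1 1) * w 0 1.
Proof. by rewrite /inner !mxE sum2 !mxE !sum2. Qed.

Lemma det2E (M : 'M[R]_2) : \det M = M 0 0 * M 1 1 - M 0 1 * M 1 0.
Proof.
rewrite (expand_det_row _ 0) sum2 /cofactor !det_mx11 !mxE /=.
rewrite (_ : lift 0 0 = 1); last exact/val_inj.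
rewrite (_ : lift 1 0 = 0); last exact/val_inj.
by rewrite /= expr0 expr1; ring.
Qed.

Lemma invmx2E (M : 'M[R]_2) : \det M != 0 ->
  [/\ invmx M 0 0 = M 1 1 / \det M, invmx M 0 1 = - (M 0 1 / \det M),
      invmx M 1 0 = - (M 1 0 / \det M) & invmx M 1 1 = M 0 0 / \det M].
Proof.
move=> d0; have uM : M \in unitmx by rewrite unitmxE unitfE.
have E i j : (M *m invmx M) i j = (i == j)%:R by rewrite mulmxV// mxE.
have := E 0 0; have := E 0 1; have := E 1 0; have := E 1 1.
rewrite !mxE !sum2 /=; move: d0; rewrite det2E.
set a := M 0 0; set b := M 0 1; set b' := M 1 0; set c := M 1 1.
set p := invmx M 0 0; set q := invmx M 0 1; set r := invmx M 1 0; set s := invmx M 1 1.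
move=> d0 e11 e10 e01 e00.
split; apply: (mulIf d0); rewrite ?mulNr divfK//.
- have -> : p * (a * c - b * b') = c * (a * p + b * r) - b * (b' * p + c * r) by ring.
  by rewrite e00 e10 mulr1 mulr0 subr0.
- have -> : q * (a * c - b * b') = c * (a * q + b * s) - b * (b' * q + c * s) by ring.
  by rewrite e01 e11 mulr1 mulr0 add0r.
- have -> : r * (a * c - b * b') = a * (b' * p + c * r) - b' * (a * p + b * r) by ring.
  by rewrite e00 e10 mulr1 mulr0 add0r.
- have -> : s * (a * c - b * b') = a * (b' * q + c * s) - b' * (a * q + b * s) by ring.
  by rewrite e01 e11 mulr1 mulr0 subr0.
Qed.

End bilinear.

(** * Pointwise identities behind the Bochner formula *)

Section pointwise_algebra.
Variable R : realFieldType.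

(* [Cijk] is the component [k] of [(nabla_i A) e_j], where [A = nabla grad u];
   the last two hypotheses are the Ricci identity [R(e_0, e_1) grad u]. *)
Fact bochner_contraction (a b c K V0 V1
    C000 C001 C010 C011 C100 C101 C110 C111 : R) :
  let ip X0 X1 Y0 Y1 := (X0 * a + X1 * b) * Y0 + (X0 * b + X1 * c) * Y1 in
  let d := a * c - b ^+ 2 in
  C000 + C011 = 0 -> C100 + C111 = 0 ->
  ip C000 C001 0 1 = ip C010 C011 1 0 ->
  ip C100 C101 0 1 = ip C110 C111 1 0 ->
  ip (C010 - C100) (C011 - C101) 1 0 = K * d * V1 ->
  ip (C010 - C100) (C011 - C101) 0 1 = - (K * d * V0) ->
  c * ip C000 C001 V0 V1 - b * (ip C010 C011 V0 V1 + ip C100 C101 V0 V1)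
  + a * ip C110 C111 V0 V1 = K * d * ip V0 V1 V0 V1.
Proof.
move=> ip d T0 T1 S0 S1 R0 R1; rewrite /ip /d in S0 S1 R0 R1 *.
(* The symmetry and Ricci hypotheses as vanishing residuals; the goal is an explicit combination of
   these and of the two traces. *)
pose s0 := C000 * b + C001 * c - (C010 * a + C011 * b).
pose s1 := C100 * b + C101 * c - (C110 * a + C111 * b).
pose r0 := (C010 - C100) * a + (C011 - C101) * b - K * (a * c - b ^+ 2) * V1.
pose r1 := (C010 - C100) * b + (C011 - C101) * c + K * (a * c - b ^+ 2) * V0.
have s00 : s0 = 0 by rewrite /s0; move: S0; rewrite !mulr1 !mulr0 addr0 add0r => ->; ring.
have s10 : s1 = 0 by rewrite /s1; move: S1; rewrite !mulr1 !mulr0 addr0 add0r => ->; ring.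
have r00 : r0 = 0 by rewrite /r0; move: R0; rewrite !mulr1 !mulr0 addr0 => ->; ring.
have r10 : r1 = 0 by rewrite /r1; move: R1; rewrite !mulr1 !mulr0 add0r => ->; ring.
apply/eqP; rewrite -subr_eq0; apply/eqP.
transitivity (V0 * ((a * c - b ^+ 2) * (C000 + C011) + b * s0 - a * s1 + b * r0 - a * r1)
  + V1 * ((a * c - b ^+ 2) * (C100 + C111) + c * s0 - b * s1 + c * r0 - b * r1)).
  by rewrite /s0 /s1 /r0 /r1; ring.
by rewrite T0 T1 s00 s10 r00 r10; ring.
Qed.

(* Cayley-Hamilton: a trace-free [m] satisfies [m^2 = - det m], hence
   [m^2 = mu^2] for an eigenvalue [mu]. *)
Fact eigen_norm (a b c V0 V1 m00 m01 m10 m11 mu : R) :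
  let ip X0 X1 Y0 Y1 := (X0 * a + X1 * b) * Y0 + (X0 * b + X1 * c) * Y1 in
  let d := a * c - b ^+ 2 in
  m00 + m11 = 0 -> ip m00 m01 0 1 = ip m10 m11 1 0 ->
  ip m00 m01 V0 V1 = mu * ip V0 V1 1 0 ->
  ip m10 m11 V0 V1 = mu * ip V0 V1 0 1 -> ip V0 V1 V0 V1 != 0 ->
  c * ip m00 m01 m00 m01 - b * (ip m00 m01 m10 m11 + ip m10 m11 m00 m01)
  + a * ip m10 m11 m10 m11 = 2 * d * mu ^+ 2.
Proof.
move=> ip d T S E0 E1 Q0; rewrite /ip /d in S E0 E1 Q0 *.
(* The lowered components of [V]; [F0] and [F1] say that they form an eigenvector of [m]. *)
pose u0 := V0 * a + V1 * b; pose u1 := V0 * b + V1 * c.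
have m11E : m11 = - m00 by rewrite -[LHS](addrK m00) [m11 + _]addrC T sub0r.
have SE : m10 * a = 2 * m00 * b + m01 * c.
  by move: S; rewrite m11E => S; move: S; rewrite !mulr1 !mulr0 addr0 add0r => S; lra.
have F0 : m00 * u0 + m01 * u1 = mu * u0.
  by rewrite /u0 /u1 -[RHS]/(mu * (V0 * a + V1 * b)); move: E0; rewrite mulr1 mulr0 addr0 => <-; ring.
have F1 : m10 * u0 + m11 * u1 = mu * u1.
  by rewrite /u0 /u1; move: E1; rewrite mulr1 mulr0 add0r => <-; ring.
have G0 : (m00 ^+ 2 + m01 * m10) * u0 = mu ^+ 2 * u0.
  transitivity (m00 * (m00 * u0 + m01 * u1) + m01 * (m10 * u0 + m11 * u1)).
    by rewrite m11E; ring.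
  rewrite F0 F1; transitivity (mu * (m00 * u0 + m01 * u1)); first by ring.
  by rewrite F0; ring.
have G1 : (m00 ^+ 2 + m01 * m10) * u1 = mu ^+ 2 * u1.
  transitivity (m10 * (m00 * u0 + m01 * u1) + m11 * (m10 * u0 + m11 * u1)).
    by rewrite m11E; ring.
  rewrite F0 F1; transitivity (mu * (m10 * u0 + m11 * u1)); first by ring.
  by rewrite F1; ring.
have mm : m00 ^+ 2 + m01 * m10 = mu ^+ 2.
  have : (m00 ^+ 2 + m01 * m10) * (u0 * V0 + u1 * V1) = mu ^+ 2 * (u0 * V0 + u1 * V1).
    by rewrite !mulrDr !mulrA G0 G1.
  by apply: mulIf; move: Q0; rewrite /u0 /u1.
rewrite -mm m11E.
have {}SE : m10 * a - 2 * m00 * b - m01 * c = 0 by rewrite SE; ring.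
apply/eqP; rewrite -subr_eq0; apply/eqP.
(* The defect is exactly the square of the symmetry relation [SE]. *)
transitivity ((m10 * a - 2 * m00 * b - m01 * c) ^+ 2); last by rewrite SE expr0n.
ring.
Qed.

(* [p], [q], [r] stand for the Christoffel symbols [Gamma_00], [Gamma_01],
   [Gamma_11], [Aij] for the components of [nabla_i grad u], and [Bijk] for those
   of [nabla_i (nabla_j grad u)]; [F] computes the second derivatives of
   [Q * W], which are contracted with [det g * g^-1]. *)
Fact max_hessian_trace (a b c K V0 V1 p0 p1 q0 q1 r0 r1
    A00 A01 A10 A11 B000 B001 B010 B011 B100 B101 B110 B111
    u0 u1 u00 u01 u10 u11 Q W W1 W2 : R) :
  let ip X0 X1 Y0 Y1 := (X0 * a + X1 * b) * Y0 + (X0 * b + X1 * c) * Y1 in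
  let d := a * c - b ^+ 2 in
  W != 0 -> Q != 0 -> Q = ip V0 V1 V0 V1 ->
  A00 + A11 = 0 -> ip A00 A01 0 1 = ip A10 A11 1 0 ->
  B000 + B011 = p0 * A00 + q0 * A01 + p1 * A10 + q1 * A11 ->
  B100 + B111 = q0 * A00 + r0 * A01 + q1 * A10 + r1 * A11 ->
  ip B000 B001 0 1 + ip A00 A01 q0 q1 = ip B010 B011 1 0 + ip A10 A11 p0 p1 ->
  ip B100 B101 0 1 + ip A00 A01 r0 r1 = ip B110 B111 1 0 + ip A10 A11 q0 q1 ->
  ip (B010 - B100) (B011 - B101) 1 0 = K * d * V1 ->
  ip (B010 - B100) (B011 - B101) 0 1 = - (K * d * V0) ->
  u0 = ip V0 V1 1 0 -> u1 = ip V0 V1 0 1 ->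
  u00 = ip A00 A01 1 0 + ip V0 V1 p0 p1 ->
  u01 = ip A00 A01 0 1 + ip V0 V1 q0 q1 ->
  u10 = ip A10 A11 1 0 + ip V0 V1 q0 q1 ->
  u11 = ip A10 A11 0 1 + ip V0 V1 r0 r1 ->
  2 * ip A00 A01 V0 V1 * W + Q * (W1 * u0) = 0 ->
  2 * ip A10 A11 V0 V1 * W + Q * (W1 * u1) = 0 ->
  let F B0 B1 X0 X1 Y0 Y1 ui uj uij :=
    2 * (ip B0 B1 V0 V1 + ip Y0 Y1 X0 X1) * W + 2 * ip Y0 Y1 V0 V1 * (W1 * ui)
    + (2 * ip X0 X1 V0 V1 * (W1 * uj) + Q * (W2 * ui * uj + W1 * uij)) in
  c * F B000 B001 A00 A01 A00 A01 u0 u0 u00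
  - b * (F B010 B011 A00 A01 A10 A11 u0 u1 u01
         + F B100 B101 A10 A11 A00 A01 u1 u0 u10)
  + a * F B110 B111 A10 A11 A10 A11 u1 u1 u11 =
  d * (2 * W * K * Q + Q ^+ 2 * (W2 - W1 ^+ 2 / W)).
Proof.
move=> ip d W0 Q0 QE HT HS T0 T1 S0 S1 R0 R1 u0E u1E u00E u01E u10E u11E F0 F1 F.
(* Vanishing of grad P says that the Hessian of u maps grad u to a multiple of itself; solving [F0]
   and [F1] for the multiple gives this eigenvalue. *)
pose mu := - (Q * W1) / (2 * W).
have al0 : ip A00 A01 V0 V1 = mu * u0.
  have W20 : 2 * W != 0 by rewrite mulf_neq0// pnatr_eq0.
  apply: (mulIf W20); rewrite /mu mulrAC divfK//; move: F0; set y := ip _ _ _ _ => F0.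
  by apply/eqP; rewrite -subr_eq0 -F0; apply/eqP; ring.
have al1 : ip A10 A11 V0 V1 = mu * u1.
  have W20 : 2 * W != 0 by rewrite mulf_neq0// pnatr_eq0.
  apply: (mulIf W20); rewrite /mu mulrAC divfK//; move: F1; set y := ip _ _ _ _ => F1.
  by apply/eqP; rewrite -subr_eq0 -F1; apply/eqP; ring.
have EN : c * ip A00 A01 A00 A01 - b * (ip A00 A01 A10 A11 + ip A10 A11 A00 A01)
    + a * ip A10 A11 A10 A11 = 2 * d * mu ^+ 2.
  have := @eigen_norm a b c V0 V1 A00 A01 A10 A11 mu HT HS.
  by rewrite -/(ip V0 V1 1 0) -/(ip V0 V1 0 1) -u0E -u1E -/(ip V0 V1 V0 V1) -QE; apply.
(* Subtracting Christoffel terms turns iterated covariant derivatives along coordinate fields into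
   components of the tensor of second covariant derivatives, to which [bochner_contraction]
   applies. *)
pose Cf i j B (X Y : R) := B - i * X - j * Y.
have BC : c * ip (Cf p0 p1 B000 A00 A10) (Cf p0 p1 B001 A01 A11) V0 V1
    - b * (ip (Cf q0 q1 B010 A00 A10) (Cf q0 q1 B011 A01 A11) V0 V1
           + ip (Cf q0 q1 B100 A00 A10) (Cf q0 q1 B101 A01 A11) V0 V1)
    + a * ip (Cf r0 r1 B110 A00 A10) (Cf r0 r1 B111 A01 A11) V0 V1 = K * d * Q.
  rewrite QE; apply: bochner_contraction; rewrite /Cf.
  - transitivity (B000 + B011 - (p0 * A00 + q0 * A01 + p1 * A10 + q1 * A11)); first by ring.
    by rewrite T0 subrr.
  - transitivity (B100 + B111 - (q0 * A00 + r0 * A01 + q1 * A10 + r1 * A11)); first by ring.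
    by rewrite T1 subrr.
  - apply/eqP; rewrite -subr_eq0; apply/eqP.
    transitivity ((ip B000 B001 0 1 + ip A00 A01 q0 q1 - (ip B010 B011 1 0 + ip A10 A11 p0 p1))
       + (p0 + q1) * (ip A10 A11 1 0 - ip A00 A01 0 1)); first by rewrite /ip; ring.
    by rewrite S0 HS !subrr; ring.
  - apply/eqP; rewrite -subr_eq0; apply/eqP.
    transitivity ((ip B100 B101 0 1 + ip A00 A01 r0 r1 - (ip B110 B111 1 0 + ip A10 A11 q0 q1))
       + (q0 + r1) * (ip A10 A11 1 0 - ip A00 A01 0 1)); first by rewrite /ip; ring.
    by rewrite S1 HS !subrr; ring.
  - by rewrite -/d -R0 /ip; ring.
  - by rewrite -/d -R1 /ip; ring.
have Suu : c * (u0 * u0) - b * (u0 * u1 + u1 * u0) + a * (u1 * u1) = d * Q.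
  by rewrite u0E u1E QE /ip /d; ring.
have SA : c * ip A00 A01 1 0 - b * (ip A00 A01 0 1 + ip A10 A11 1 0) + a * ip A10 A11 0 1 = 0.
  by transitivity (d * (A00 + A11)); [rewrite /ip /d; ring|rewrite HT mulr0].
pose FF B0 B1 X0 X1 Y0 Y1 ui uj uij := 2 * W * (ip B0 B1 V0 V1)
  + 2 * W * ip Y0 Y1 X0 X1 + 4 * W1 * mu * (ui * uj) + Q * W2 * (ui * uj) + Q * W1 * uij.
have ipC i j B0 B1 : ip (Cf i j B0 A00 A10) (Cf i j B1 A01 A11) V0 V1 =
    ip B0 B1 V0 V1 - i * (mu * u0) - j * (mu * u1).
  by rewrite -al0 -al1 /ip /Cf; ring.
have ipV i j : ip V0 V1 i j = i * u0 + j * u1 by rewrite u0E u1E /ip; ring.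
rewrite !ipC in BC; rewrite ipV in u00E; rewrite ipV in u01E.
rewrite ipV in u10E; rewrite ipV in u11E.
rewrite al0 in F0; rewrite al1 in F1.
(* Regrouped as the curvature term, the norm of the Hessian, the cross terms, the second derivative
   of the weight, and a multiple of the Laplacian of u, which is 0. *)
have -> : d * (2 * W * K * Q + Q ^+ 2 * (W2 - W1 ^+ 2 / W)) =
  2 * W * (K * d * Q) + 2 * W * (2 * d * mu ^+ 2) + 4 * W1 * mu * (d * Q) + Q * W2 * (d * Q)
  + Q * W1 * 0.
  by rewrite /mu; field.
rewrite -BC -EN -Suu -SA /F u00E u01E u10E u11E al0 al1.
apply/eqP; rewrite -subr_eq0; apply/eqP.
(* What remains is the difference between the coordinate Hessian and the covariant one: traced
   Christoffel symbols times the first derivatives of P, which vanish. *)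
transitivity ((c * p0 - 2 * b * q0 + a * r0) * (2 * (mu * u0) * W + Q * (W1 * u0))
  + (c * p1 - 2 * b * q1 + a * r1) * (2 * (mu * u1) * W + Q * (W1 * u1))).
  ring.
by rewrite F0 F1 !mulr0 addr0.
Qed.

End pointwise_algebra.

(** The data of one chart, with an explicit open [U0] witnessing that [D] is relatively open. The
    local estimates are stated over it, so the atlas enters only when charts are compared. *)
Record metric_on (R : realType) (U0 D : set (plane R)) (g : plane R -> 'M[R]_2)
    : Prop := MetricOn {
  dom_open : open U0 ;
  dom_half : D = U0 `&` @half_plane R ;
  g_smooth : forall i j, smooth_on D (fun x => g x i j) ;
  g_sym : forall x, D x -> (g x)^T = g x ;
  g_pos : forall x, D x -> forall v : plane R, v != 0 ->
    0 < (v *m g x *m v^T) 0 0 }.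

Definition smooth_field (R : realType) (D : set (plane R)) (X : plane R -> plane R) :=
  forall k, smooth_on D (fun x => X x 0 k).

(* R(e_0, e_1) X, without bracket term since coordinate fields commute. *)
Definition curv01 (R : realType) (g : plane R -> 'M[R]_2) (X : plane R -> plane R)
    (x : plane R) : plane R :=
  nabla g (@coord_field R 0) (nabla g (@coord_field R 1) X) x
  - nabla g (@coord_field R 1) (nabla g (@coord_field R 0) X) x.

(** * Levi-Civita connection and curvature in a chart *)

Section local_geometry.
Local Opaque pderiv.
Variables (R : realType) (U0 D : set (plane R)) (g : plane R -> 'M[R]_2).
Hypothesis gH : metric_on U0 D g.

Let U0_open : open U0 := dom_open gH.
Let DE : D = U0 `&` @half_plane R := dom_half gH.
Let g_smooth := g_smooth gH.
Let g_sym := g_sym gH.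
Let g_pos := g_pos gH.

Local Notation e i := (@coord_field R i).
Local Notation N i := (nabla g (e i)).
Local Notation Gam := (christoffel g).
Local Notation smooth_field := (smooth_field D).

Lemma g10 x : D x -> g x 1 0 = g x 0 1.
Proof. by move=> /g_sym gx; rewrite -{1}gx mxE. Qed.

Lemma g00_gt0 x : D x -> 0 < g x 0 0.
Proof.
move=> Dx; have := @g_pos x Dx (bvec R 0).
rewrite -/(inner g x _ _) innerE !bvecE /= => H.
have : bvec R 0 != 0.
  by apply/eqP => /rowP/(_ 0)/eqP; rewrite bvecE mxE eqxx oner_eq0.
by move=> /H; rewrite !mulr0 !mulr1 !mul1r !mul0r !addr0.
Qed.

Lemma det_gt0 x : D x -> 0 < \det (g x).
Proof.
move=> Dx; have a0 := g00_gt0 Dx.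
(* This vector is orthogonal to the first coordinate field, and its squared length is
   [g x 0 0 * \det (g x)]. *)
pose v : plane R := - g x 0 1 *: bvec R 0 + g x 0 0 *: bvec R 1.
have v0 : v != 0.
  apply/eqP => /rowP/(_ 1)/eqP; rewrite !mxE /= mulr0 add0r mulr1.
  by rewrite gt_eqF.
have := @g_pos x Dx v v0; rewrite -/(inner g x _ _) innerE det2E !mxE /= g10//.
set a := g x 0 0 in a0 *; set b := g x 0 1; set c := g x 1 1 => H.
by rewrite -(pmulr_rgt0 _ a0); apply: le_lt_trans H _ || (move: H; nra).
Qed.

Lemma detD x : D x -> \det (g x) = g x 0 0 * g x 1 1 - g x 0 1 ^+ 2.
Proof. by move=> Dx; rewrite det2E (g10 Dx) expr2. Qed.

Lemma smooth_det : smooth_on D (fun x => \det (g x)).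
Proof.
apply: (@smooth_eq _ _ (fun x => g x 0 0 * g x 1 1 - g x 0 1 * g x 1 0)).
  by move=> x _; rewrite det2E.
by apply: smoothB; apply: smoothM.
Qed.

(** The inverse is a real power with exponent -1, so smoothness of powers of positive functions
    covers it. *)
Lemma smooth_detV : smooth_on D (fun x => (\det (g x))^-1).
Proof.
apply: (@smooth_eq _ _ (fun x => \det (g x) `^ (-1))).
  by move=> x /set_mem Dx; rewrite powR_inv1// ltW// det_gt0.
apply: smooth_powR; last exact: smooth_det.
by move=> x /set_mem Dx; exact: det_gt0.
Qed.

Lemma smooth_inv i j : smooth_on D (fun x => invmx (g x) i j).
Proof.
have K x : x \in D -> \det (g x) != 0 by move=> /set_mem Dx; rewrite gt_eqF// det_gt0.
move: i j; apply: ord2P; apply: ord2P.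
- apply: (@smooth_eq _ _ (fun x => g x 1 1 * (\det (g x))^-1)).
    by move=> x /K /invmx2E[-> _ _ _].
  by apply: smoothM => //; exact: smooth_detV.
- apply: (@smooth_eq _ _ (fun x => - (g x 0 1 * (\det (g x))^-1))).
    by move=> x /K /invmx2E[_ -> _ _].
  by apply: smoothN; apply: smoothM => //; exact: smooth_detV.
- apply: (@smooth_eq _ _ (fun x => - (g x 1 0 * (\det (g x))^-1))).
    by move=> x /K /invmx2E[_ _ -> _].
  by apply: smoothN; apply: smoothM => //; exact: smooth_detV.
- apply: (@smooth_eq _ _ (fun x => g x 0 0 * (\det (g x))^-1)).
    by move=> x /K /invmx2E[_ _ _ ->].
  by apply: smoothM => //; exact: smooth_detV.
Qed.

Lemma smooth_Gam k i j : smooth_on D (Gam k i j).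
Proof.
rewrite /christoffel.
under eq_fun do rewrite sum2.
have P a b c : smooth_on D (pderiv a (fun y => g y b c)).
  exact: (smooth_pderiv U0_open DE).
apply: smoothM; first exact: smooth_cst.
by apply: smoothD; apply: smoothM; try exact: smooth_inv;
  apply: smoothB => //; apply: smoothD.
Qed.

Lemma NE i X k x : N i X x 0 k = pderiv i (fun y => X y 0 k) x
  + (Gam k i 0 x * X x 0 0 + Gam k i 1 x * X x 0 1).
Proof.
rewrite /nabla mxE sum2 !sum2 /coord_field.
by case: (@ord2P (fun i => i = 0 \/ i = 1)  _ _ i) => [||->|->]; auto;
  rewrite !bvecE /= mul1r mul0r ?addr0 ?add0r.
Qed.

Lemma nabla_expand Y X x : nabla g Y X x = Y x 0 0 *: N 0 X x + Y x 0 1 *: N 1 X x.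
Proof.
apply/rowP => k; rewrite [RHS]mxE [X in _ = X + _]mxE [X in _ = _ + X]mxE !NE.
by rewrite mxE !sum2.
Qed.

Lemma smooth_e i : smooth_field (e i).
Proof. by move=> k; rewrite /coord_field; exact: smooth_cst. Qed.

Lemma smooth_N i X : smooth_field X -> smooth_field (N i X).
Proof.
move=> sX k; have P := smooth_Gam.
apply: (@smooth_eq _ _ (fun x => pderiv i (fun y => X y 0 k) x
  + (Gam k i 0 x * X x 0 0 + Gam k i 1 x * X x 0 1))).
  by move=> x _; rewrite NE.
apply: smoothD; first exact: (smooth_pderiv U0_open DE).
by apply: smoothD; apply: smoothM.
Qed.

Lemma smooth_inner X Y : smooth_field X -> smooth_field Y ->
  smooth_on D (fun y => inner g y (X y) (Y y)).
Proof.
move=> sX sY; apply: (@smooth_eq _ _ (fun y =>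
  (X y 0 0 * g y 0 0 + X y 0 1 * g y 1 0) * Y y 0 0 +
  (X y 0 0 * g y 0 1 + X y 0 1 * g y 1 1) * Y y 0 1)).
  by move=> x _; rewrite innerE.
by apply: smoothD; apply: smoothM => //; apply: smoothD; apply: smoothM.
Qed.

Lemma pderiv_g i j k x : D x -> pderiv i (fun y => g y j k) x = pderiv i (fun y => g y k j) x.
Proof.
move=> Dx; apply: (pderiv_eq U0_open DE) => // y /set_mem Dy.
by rewrite -{1}(g_sym Dy) mxE.
Qed.

Lemma Gam_sym k i j x : D x -> Gam k i j x = Gam k j i x.
Proof.
move=> Dx; rewrite /christoffel !sum2.
rewrite (pderiv_g 0 i j Dx) (pderiv_g 1 i j Dx).
rewrite (addrC (pderiv i (fun y => g y j 0) x)).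
by rewrite (addrC (pderiv i (fun y => g y j 1) x)).
Qed.

(** Lowering the index cancels the inverse metric and leaves the Koszul formula for coordinate
    fields. *)
Lemma Gam_lower m i j x : D x ->
  g x m 0 * Gam 0 i j x + g x m 1 * Gam 1 i j x =
  2^-1 * (pderiv i (fun y => g y j m) x + pderiv j (fun y => g y i m) x
          - pderiv m (fun y => g y i j) x).
Proof.
move=> Dx; have d0 : \det (g x) != 0 by rewrite gt_eqF// det_gt0.
have uM : g x \in unitmx by rewrite unitmxE unitfE.
have E k l : (g x *m invmx (g x)) k l = (k == l)%:R by rewrite mulmxV// mxE.
have E0 := E m 0; have E1 := E m 1; move: E0 E1; rewrite !mxE !sum2 => E0 E1.
rewrite /christoffel !sum2.
set t0 := pderiv i _ x + _ - pderiv 0 _ x; set t1 := pderiv i _ x + _ - pderiv 1 _ x.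
transitivity (2^-1 * ((g x m 0 * invmx (g x) 0 0 + g x m 1 * invmx (g x) 1 0) * t0
  + (g x m 0 * invmx (g x) 0 1 + g x m 1 * invmx (g x) 1 1) * t1)); first by ring.
rewrite E0 E1; congr (_ * _).
by case: (@ord2P (fun m => m = 0 \/ m = 1)  _ _ m) => [||->|->]; auto;
  rewrite /= mul1r mul0r ?addr0 ?add0r.
Qed.

Lemma metric_compat i j k x : D x -> pderiv i (fun y => g y j k) x =
  (g x k 0 * Gam 0 i j x + g x k 1 * Gam 1 i j x) +
  (g x j 0 * Gam 0 i k x + g x j 1 * Gam 1 i k x).
Proof.
move=> Dx; rewrite !Gam_lower//.
rewrite (pderiv_g i k j Dx).
set p := pderiv i _ x; set q := pderiv j _ x; set r := pderiv k _ x.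
by field.
Qed.

Lemma N_torsion i j x : D x -> N i (e j) x = N j (e i) x.
Proof.
move=> Dx; apply/rowP => k; rewrite !NE /coord_field.
rewrite !(pderiv_cst DE)// !bvecE.
case: (@ord2P (fun i => i = 0 \/ i = 1)  _ _ i) => [||->|->]; auto;
case: (@ord2P (fun i => i = 0 \/ i = 1)  _ _ j) => [||->|->]; auto => //=.
  by rewrite !mulr0 !mulr1 !addr0 !add0r Gam_sym.
by rewrite !mulr0 !mulr1 !addr0 !add0r Gam_sym.
Qed.

Lemma inner_compat i X Y x : smooth_field X -> smooth_field Y -> D x ->
  pderiv i (fun y => inner g y (X y) (Y y)) x =
  inner g x (N i X x) (Y x) + inner g x (X x) (N i Y x).
Proof.
move=> sX sY Dx.
rewrite (@pderiv_eq _ _ _ U0_open DE _ (fun y =>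
  (X y 0 0 * g y 0 0 + X y 0 1 * g y 1 0) * Y y 0 0 +
  (X y 0 0 * g y 0 1 + X y 0 1 * g y 1 1) * Y y 0 1))//; last first.
  by move=> y _; rewrite innerE.
have S1 j : smooth_on D (fun y => X y 0 0 * g y 0 j + X y 0 1 * g y 1 j).
  by apply: smoothD; apply: smoothM.
have S2 j : smooth_on D (fun y => (X y 0 0 * g y 0 j + X y 0 1 * g y 1 j) * Y y 0 j).
  by apply: smoothM.
have S3 k j : smooth_on D (fun y => X y 0 k * g y k j) by apply: smoothM.
rewrite (pderivD U0_open DE)//.
rewrite !(pderivM U0_open DE)// !(pderivD U0_open DE)// !(pderivM U0_open DE)//.
rewrite !metric_compat// !innerE !NE (g10 Dx).
set a := g x 0 0; set b := g x 0 1; set c := g x 1 1.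
ring.
Qed.

Local Notation Rm := (curv01 g).

Lemma innerC x v w : D x -> inner g x v w = inner g x w v.
Proof. by move=> Dx; rewrite !innerE (g10 Dx); ring. Qed.

Lemma innerBl x v v' w : inner g x (v - v') w = inner g x v w - inner g x v' w.
Proof. by rewrite !innerE !mxE; ring. Qed.

Lemma inner_e x v k : inner g x v (e k x) = v 0 0 * g x 0 k + v 0 1 * g x 1 k.
Proof.
rewrite innerE /coord_field !bvecE; move: k.
by apply: ord2P; rewrite /= !mulr0 !mulr1 ?addr0 ?add0r.
Qed.

(** Differentiate the function <X, Y> twice by metric compatibility. Its second derivatives commute,
    the mixed terms cancel, and the curvature terms are left. *)
Lemma curvature_skew X Y x : smooth_field X -> smooth_field Y -> D x ->
  inner g x (Rm X x) (Y x) + inner g x (X x) (Rm Y x) = 0.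
Proof.
move=> sX sY Dx.
have s1 i Z : smooth_field Z -> smooth_field (N i Z) by exact: smooth_N.
have E i j : pderiv i (pderiv j (fun y => inner g y (X y) (Y y))) x =
    inner g x (N i (N j X) x) (Y x) + inner g x (N j X x) (N i Y x)
    + (inner g x (N i X x) (N j Y x) + inner g x (X x) (N i (N j Y) x)).
  rewrite (@pderiv_eq _ _ _ U0_open DE _ (fun y =>
    inner g y (N j X y) (Y y) + inner g y (X y) (N j Y y)))//; last first.
    by move=> y /set_mem Dy; exact: inner_compat.
  rewrite (pderivD U0_open DE)//; last 2 first.
  - exact: smooth_inner (s1 j X sX) sY.
  - exact: smooth_inner sX (s1 j Y sY).
  by rewrite (inner_compat i (s1 j X sX) sY Dx) (inner_compat i sX (s1 j Y sY) Dx).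
have C : pderiv 0 (pderiv 1 (fun y => inner g y (X y) (Y y))) x =
    pderiv 1 (pderiv 0 (fun y => inner g y (X y) (Y y))) x.
  by apply: (pderivC U0_open DE) => //; exact: smooth_inner.
rewrite (E 0 1) (E 1 0) in C.
rewrite /curv01 innerBl (innerC _ (_ - _) Dx) innerBl.
rewrite -(innerC (X x) _ Dx) -(innerC (X x) _ Dx).
move: C; set a1 := inner g x (N 0 (N 1 X) x) _; set a2 := inner g x (N 1 (N 0 X) x) _.
set b1 := inner g x (X x) (N 0 (N 1 Y) x); set b2 := inner g x (X x) (N 1 (N 0 Y) x).
by lra.
Qed.

Lemma gauss_curvatureE x : D x ->
  inner g x (Rm (e 1) x) (e 0 x) = gauss_curvature g x * \det (g x).
Proof.
by move=> Dx; rewrite /gauss_curvature divfK// gt_eqF// det_gt0.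
Qed.

(** Skewness moves the curvature operator from [X] to the coordinate field, so only the value of [X]
    at [x] matters. A skew operator in dimension two is determined by one number, here
    [gauss_curvature g x * \det (g x)]. *)
Lemma curvature_e0 X x : smooth_field X -> D x ->
  inner g x (Rm X x) (e 0 x) = gauss_curvature g x * \det (g x) * X x 0 1.
Proof.
move=> sX Dx; have := curvature_skew sX (smooth_e 0) Dx.
have S00 := curvature_skew (smooth_e 0) (smooth_e 0) Dx.
have S10 := curvature_skew (smooth_e 1) (smooth_e 0) Dx.
move/eqP; rewrite addr_eq0 => /eqP ->.
move: S00 S10; rewrite [inner g x (e 0 x) _](innerC _ _ Dx) gauss_curvatureE//.
rewrite [inner g x (e 1 x) _](innerC _ _ Dx) !inner_e innerE.
set r0 := Rm (e 0) x 0 0; set r1 := Rm (e 0) x 0 1; rewrite (g10 Dx).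
set kk := gauss_curvature _ _ * _ => S00 S10.
have S00' : r0 * g x 0 0 + r1 * g x 0 1 = 0 by lra.
have -> : kk = - (r0 * g x 0 1 + r1 * g x 1 1) by lra.
transitivity (- (X x 0 0 * (r0 * g x 0 0 + r1 * g x 0 1) + X x 0 1 * (r0 * g x 0 1 + r1 * g x 1 1))).
  by ring.
by rewrite S00'; ring.
Qed.

Lemma curvature_e1 X x : smooth_field X -> D x ->
  inner g x (Rm X x) (e 1 x) = - (gauss_curvature g x * \det (g x) * X x 0 0).
Proof.
move=> sX Dx; have := curvature_skew sX (smooth_e 1) Dx.
have S11 := curvature_skew (smooth_e 1) (smooth_e 1) Dx.
have := gauss_curvatureE Dx.
move=> GE /eqP; rewrite addr_eq0 => /eqP ->.
move: S11 GE; rewrite [inner g x (e 1 x) _](innerC _ _ Dx).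
rewrite !inner_e innerE.
set r0 := Rm (e 1) x 0 0; set r1 := Rm (e 1) x 0 1; rewrite (g10 Dx).
set kk := gauss_curvature _ _ * _ => S11 <-.
have S11' : r0 * g x 0 1 + r1 * g x 1 1 = 0 by lra.
transitivity (- (X x 0 1 * (r0 * g x 0 1 + r1 * g x 1 1) + X x 0 0 * (r0 * g x 0 0 + r1 * g x 0 1))).
  by ring.
by rewrite S11'; ring.
Qed.

End local_geometry.

(** * Harmonic functions *)

Definition grad_sq (R : realType) (g : plane R -> 'M[R]_2) (u : plane R -> R)
    (x : plane R) : R :=
  inner g x (grad g u x) (grad g u x).

(** Multiplied by [a], the trace is the determinant times the form on e_0 plus the form on (-b, a).
    These two vectors are orthogonal for the metric, and both point into the closed half-plane. *)
Fact cofactor_trace_le0 (R : realFieldType) (a b c F00 F01 F10 F11 : R) :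
  0 < a -> 0 < a * c - b ^+ 2 ->
  1 ^+ 2 * F00 + 1 * 0 * (F01 + F10) + 0 ^+ 2 * F11 <= 0 ->
  (- b) ^+ 2 * F00 + - b * a * (F01 + F10) + a ^+ 2 * F11 <= 0 ->
  0 < c * F00 - b * (F01 + F10) + a * F11 -> False.
Proof.
move=> a0 d0; rewrite expr1n expr0n /= mul1r mulr0 !mul0r !addr0 => H1 H2.
rewrite -(pmulr_rgt0 _ a0).
have -> : a * (c * F00 - b * (F01 + F10) + a * F11) =
  (a * c - b ^+ 2) * F00 + ((- b) ^+ 2 * F00 + - b * a * (F01 + F10) + a ^+ 2 * F11) by ring.
by apply/negP; rewrite -leNgt -[0]addr0 lerD// mulr_ge0_le0// ltW.
Qed.

Section harmonic.
Local Opaque pderiv christoffel nabla.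
Variables (R : realType) (U0 D : set (plane R)) (g : plane R -> 'M[R]_2).
Hypothesis gH : metric_on U0 D g.

Let U0_open : open U0 := dom_open gH.
Let DE : D = U0 `&` @half_plane R := dom_half gH.

Local Notation e i := (@coord_field R i).
Local Notation N i := (nabla g (e i)).
Local Notation Gam := (christoffel g).
Local Notation smooth_field := (smooth_field D).

Variable u : plane R -> R.
Hypothesis u_smooth : smooth_on D u.
Hypothesis u_harm : forall x, D x -> laplace_beltrami g u x = 0.

Local Notation V := (grad g u).
Local Notation A i := (N i V).
Local Notation Q := (grad_sq g u).
Local Notation K := (gauss_curvature g).

Lemma smooth_grad : smooth_field V.
Proof.
move=> k; apply: (@smooth_eq _ _ (fun x => invmx (g x) k 0 * pderiv 0 u x
  + invmx (g x) k 1 * pderiv 1 u x)).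
  by move=> x _; rewrite /grad mxE sum2.
by apply: smoothD; apply: smoothM; try exact: (smooth_inv gH);
  exact: (smooth_pderiv U0_open DE).
Qed.

Lemma inner_grad_e x k : D x -> inner g x (V x) (e k x) = pderiv k u x.
Proof.
move=> Dx; have d0 : \det (g x) != 0 by rewrite gt_eqF// (det_gt0 gH).
rewrite inner_e /grad !mxE !sum2.
have [-> -> -> ->] := invmx2E d0.
move: k; apply: ord2P; rewrite (g10 gH Dx); move: d0; rewrite (detD gH Dx);
  set a := g x 0 0; set b := g x 0 1; set c := g x 1 1;
  set p := pderiv 0 u x; set q := pderiv 1 u x => d0; by field.
Qed.

Lemma pderiv2_u i j x : D x -> pderiv i (pderiv j u) x =
  inner g x (A i x) (e j x) + inner g x (V x) (N i (e j) x).
Proof.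
move=> Dx; rewrite -(inner_compat gH i smooth_grad (smooth_e j) Dx).
by apply: (pderiv_eq U0_open DE) => // y /set_mem Dy; rewrite inner_grad_e.
Qed.

Lemma trace_A x : D x -> A 0 x 0 0 + A 1 x 0 1 = 0.
Proof. by move=> /u_harm; rewrite /laplace_beltrami /divergence sum2. Qed.

Lemma A_sym x : D x -> inner g x (A 0 x) (e 1 x) = inner g x (A 1 x) (e 0 x).
Proof.
move=> Dx; have := pderivC U0_open DE 0 1 u_smooth Dx.
rewrite !pderiv2_u// (N_torsion gH 0 1 Dx).
by move/addIr.
Qed.

Lemma smooth_A i : smooth_field (A i).
Proof. exact (smooth_N gH i smooth_grad). Qed.

(** [trace_A] is differentiated: the partial derivatives cancel and only the Christoffel terms of
    the covariant derivatives survive. *)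
Lemma trace_B k x : D x -> N k (A 0) x 0 0 + N k (A 1) x 0 1 =
  Gam 0 k 0 x * A 0 x 0 0 + Gam 0 k 1 x * A 0 x 0 1 +
  Gam 1 k 0 x * A 1 x 0 0 + Gam 1 k 1 x * A 1 x 0 1.
Proof.
move=> Dx; rewrite !NE.
have : pderiv k (fun y => A 0 y 0 0) x + pderiv k (fun y => A 1 y 0 1) x = 0.
  rewrite -(pderivD U0_open DE)//; try exact: smooth_A.
  rewrite (@pderiv_eq _ _ _ U0_open DE _ (fun=> 0))//; first exact: (pderiv_cst DE).
  by move=> y /set_mem; exact: trace_A.
set p := pderiv k _ x; set q := pderiv k _ x => pq.
by rewrite (addrACA p _ q) pq add0r; exact: addrA.
Qed.

Lemma B_sym k x : D x ->
  inner g x (N k (A 0) x) (e 1 x) + inner g x (A 0 x) (N k (e 1) x) =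
  inner g x (N k (A 1) x) (e 0 x) + inner g x (A 1 x) (N k (e 0) x).
Proof.
move=> Dx; rewrite -!(inner_compat gH)//; try exact: smooth_A; try exact: smooth_e.
by apply: (pderiv_eq U0_open DE) => // y /set_mem; exact: A_sym.
Qed.

(** These stand for w(u), w'(u) and w''(u); the chain rules [dW] and [dW1] are all that the
    computation of the derivatives of P asks of the weight. *)
Variables W W1 W2 : plane R -> R.
Hypothesis W_smooth : smooth_on D W.
Hypothesis W1_smooth : smooth_on D W1.
Hypothesis dW : forall i x, D x -> pderiv i W x = W1 x * pderiv i u x.
Hypothesis dW1 : forall i x, D x -> pderiv i W1 x = W2 x * pderiv i u x.
Local Notation P := (fun x => Q x * W x).

Lemma smooth_Q : smooth_on D Q.
Proof. exact (smooth_inner gH smooth_grad smooth_grad). Qed.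

Lemma smooth_P : smooth_on D P.
Proof. by apply: smoothM => //; exact: smooth_Q. Qed.

Lemma pderiv_Q i x : D x -> pderiv i Q x = 2 * inner g x (A i x) (V x).
Proof.
move=> Dx; rewrite /grad_sq (inner_compat gH i smooth_grad smooth_grad Dx).
by rewrite [inner g x (V x) _](innerC gH _ _ Dx) mulr2n mulrDl mul1r.
Qed.

Lemma pderiv_P i x : D x -> pderiv i P x =
  2 * inner g x (A i x) (V x) * W x + Q x * (W1 x * pderiv i u x).
Proof.
move=> Dx; rewrite (pderivM U0_open DE)//; last exact: smooth_Q.
by rewrite pderiv_Q// dW.
Qed.

Lemma pderiv2_P i j x : D x -> pderiv i (pderiv j P) x =
  2 * (inner g x (N i (A j) x) (V x) + inner g x (A j x) (A i x)) * W x
  + 2 * inner g x (A j x) (V x) * (W1 x * pderiv i u x)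
  + (2 * inner g x (A i x) (V x) * (W1 x * pderiv j u x)
     + Q x * (W2 x * pderiv i u x * pderiv j u x + W1 x * pderiv i (pderiv j u) x)).
Proof.
move=> Dx; have sAV := smooth_inner gH (smooth_A j) smooth_grad.
have sAV2 : smooth_on D (fun y => 2 * inner g y (A j y) (V y)).
  by apply: smoothM => //; exact: smooth_cst.
have su := smooth_pderiv U0_open DE j u_smooth.
have sWu : smooth_on D (fun y => W1 y * pderiv j u y) by exact: smoothM.
rewrite (@pderiv_eq _ _ _ U0_open DE _ (fun y =>
  2 * inner g y (A j y) (V y) * W y + Q y * (W1 y * pderiv j u y)))//; last first.
  by move=> y /set_mem; exact: pderiv_P.
have s1 := smoothM sAV2 W_smooth.
have s2 := smoothM smooth_Q sWu.
rewrite (pderivD U0_open DE i s1 s2 Dx).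
rewrite (pderivM U0_open DE i sAV2 W_smooth Dx) (pderivM U0_open DE i smooth_Q sWu Dx).
rewrite (pderivM U0_open DE i W1_smooth su Dx).
rewrite (pderivZ U0_open DE 2 i sAV Dx).
rewrite (pderiv_Q i Dx).
rewrite (dW i Dx) (dW1 i Dx).
rewrite (inner_compat gH i (smooth_A j) smooth_grad Dx).
reflexivity.
Qed.

Lemma nabla_e i j k x : D x -> N i (e j) x 0 k = Gam k i j x.
Proof.
move=> Dx; rewrite NE /coord_field (pderiv_cst DE)// !bvecE add0r; move: j; apply: ord2P.
  by rewrite /= mulr1 mulr0 addr0.
by rewrite /= mulr1 mulr0 add0r.
Qed.

Lemma coord_fieldE i k (x : plane R) : e i x 0 k = (i == k)%:R.
Proof. by rewrite /coord_field bvecE. Qed.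

Local Opaque coord_field grad.

Lemma hessian_P_trace x : D x -> Q x != 0 -> W x != 0 ->
  pderiv 0 P x = 0 -> pderiv 1 P x = 0 ->
  g x 1 1 * pderiv 0 (pderiv 0 P) x
  - g x 0 1 * (pderiv 0 (pderiv 1 P) x + pderiv 1 (pderiv 0 P) x)
  + g x 0 0 * pderiv 1 (pderiv 1 P) x =
  \det (g x) * (2 * W x * K x * Q x + Q x ^+ 2 * (W2 x - W1 x ^+ 2 / W x)).
Proof.
move=> Dx Q0 W0; rewrite !(pderiv_P _ Dx) => P0 P1; rewrite !(pderiv2_P _ _ Dx) (detD gH Dx).
have ipE X Y : inner g x X Y = (X 0 0 * g x 0 0 + X 0 1 * g x 0 1) * Y 0 0
   + (X 0 0 * g x 0 1 + X 0 1 * g x 1 1) * Y 0 1 by rewrite innerE (g10 gH Dx).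
have e00 := coord_fieldE 0 0 x; have e01 := coord_fieldE 0 1 x.
have e10 := coord_fieldE 1 0 x; have e11 := coord_fieldE 1 1 x.
rewrite /= in e00 e01 e10 e11.
have HS := A_sym Dx; have T0 := trace_B 0 Dx; have T1 := trace_B 1 Dx.
have S0 := B_sym 0 Dx; have S1 := B_sym 1 Dx.
have R0 := curvature_e0 gH smooth_grad Dx; have R1 := curvature_e1 gH smooth_grad Dx.
have Eu0 := inner_grad_e 0 Dx; have Eu1 := inner_grad_e 1 Dx.
have Eu00 := pderiv2_u 0 0 Dx; have Eu01 := pderiv2_u 0 1 Dx.
have Eu10 := pderiv2_u 1 0 Dx; have Eu11 := pderiv2_u 1 1 Dx.
have QE : Q x = inner g x (V x) (V x) by [].
have sE k i j := Gam_sym gH k i j Dx.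
have RmE k : curv01 g V x 0 k = N 0 (A 1) x 0 k - N 1 (A 0) x 0 k.
  by rewrite [LHS]mxE [X in _ + X]mxE.
rewrite !ipE ?e00 ?e01 ?e10 ?e11 in HS S0 S1 R0 R1 Eu0 Eu1 Eu00 Eu01 Eu10 Eu11 P0 P1 QE *.
rewrite (nabla_e 0 0 0 Dx) (nabla_e 0 0 1 Dx) in Eu00.
rewrite (nabla_e 0 1 0 Dx) (nabla_e 0 1 1 Dx) in Eu01.
rewrite (nabla_e 1 0 0 Dx) (nabla_e 1 0 1 Dx) (sE 0 1 0) (sE 1 1 0) in Eu10.
rewrite (nabla_e 1 1 0 Dx) (nabla_e 1 1 1 Dx) in Eu11.
rewrite (nabla_e 0 0 0 Dx) (nabla_e 0 0 1 Dx) (nabla_e 0 1 0 Dx) (nabla_e 0 1 1 Dx) in S0.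
rewrite (nabla_e 1 0 0 Dx) (nabla_e 1 0 1 Dx) (nabla_e 1 1 0 Dx) (nabla_e 1 1 1 Dx) (sE 0 1 0) (sE 1 1 0) in S1.
rewrite (sE 0 1 0) (sE 1 1 0) in T1.

rewrite !RmE in R0 R1.
rewrite (detD gH Dx) in R0 R1.
exact: (max_hessian_trace (K := K x) (W2 x) W0 Q0 QE (trace_A Dx) HS T0 T1 S0 S1 R0 R1
  (esym Eu0) (esym Eu1) Eu00 Eu01 Eu10 Eu11 P0 P1).
Qed.

(** The second-order test on e_0 and on [v] bounds the cofactor trace from above by 0, whereas
    [hessian_P_trace] makes it positive. The hypothesis on [W1] and [W2] is strict log-convexity of
    the weight. *)
Lemma no_critical_max x : D x -> (forall y, D y -> P y <= P x) ->
  pderiv 0 P x = 0 -> pderiv 1 P x = 0 -> 0 <= K x -> 0 < Q x -> 0 < W x ->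
  W1 x ^+ 2 < W x * W2 x -> False.
Proof.
move=> Dx Pmax P0 P1 K0 Q0 W0 WW.
have T := hessian_P_trace Dx (lt0r_neq0 Q0) (lt0r_neq0 W0) P0 P1.
pose v : plane R := - g x 0 1 *: bvec R 0 + g x 0 0 *: bvec R 1.
have [v0 v1] : v 0 0 = - g x 0 1 /\ v 0 1 = g x 0 0.
  by rewrite !mxE /= !mulr0 !mulr1 addr0 add0r.
have a0 := g00_gt0 gH Dx.
have [] := @pderiv_max _ _ _ U0_open DE _ x (bvec R 0) smooth_P Dx Pmax.
  by left; rewrite bvecE.
move=> _; rewrite P0 P1 !mulr0 addr0 => /(_ erefl); rewrite !bvecE /= => H1.
have [] := @pderiv_max _ _ _ U0_open DE _ x v smooth_P Dx Pmax.
  by left; rewrite v1 ltW.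
move=> _; rewrite P0 P1 !mulr0 addr0 => /(_ erefl); rewrite v0 v1 => H2.
have d0 := det_gt0 gH Dx.
have B : 0 < 2 * W x * K x * Q x + Q x ^+ 2 * (W2 x - W1 x ^+ 2 / W x).
  apply: ltr_wpDl.
    apply: mulr_ge0; last exact: ltW.
    apply: mulr_ge0; last exact: K0.
    by apply: mulr_ge0; [exact: ler0n|exact: ltW].
  by rewrite mulr_gt0// ?exprn_gt0// subr_gt0 ltr_pdivrMr// mulrC.
have := mulr_gt0 d0 B; rewrite -T; rewrite (detD gH Dx) in d0.
exact: (cofactor_trace_le0 a0 d0 H1 H2).
Qed.

End harmonic.

(** * The boundary condition *)

(** Here [n] is the unit normal, [p] and [chi] are the components of grad u along e_0 and [n], and
    [tij] is the Hessian of u. Being trace-free, the Hessian takes opposite values on the two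
    vectors of an orthonormal frame, so its value on (n, n) is [- t00 / a]. *)
Fact conormal_derivative (R : realFieldType)
    (a b c n0 n1 t00 t01 t11 p chi s W W1 Q u0 u1 : R) :
  a != 0 -> n0 * a + n1 * b = 0 -> (n0 * a + n1 * b) * n0 + (n0 * b + n1 * c) * n1 = 1 ->
  c * t00 - b * (t01 + t01) + a * t11 = 0 ->
  n0 * t00 + n1 * t01 = s -> n0 * u0 + n1 * u1 = chi ->
  n0 * (2 * ((p + chi * n0) * t00 + chi * n1 * t01) * W + Q * (W1 * u0))
  + n1 * (2 * ((p + chi * n0) * t01 + chi * n1 * t11) * W + Q * (W1 * u1)) =
  2 * W * (p * s - chi * t00 / a) + Q * W1 * chi.
Proof.
move=> a0 nt; rewrite nt mul0r add0r => nn tr ns nu.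
have K : n0 ^+ 2 * t00 + 2 * n0 * n1 * t01 + n1 ^+ 2 * t11 = - (t00 / a).
  apply: (mulfI a0); apply: (mulfI a0).
  have -> : - (t00 / a) = - (t00 / a) * ((n0 * b + n1 * c) * n1) by rewrite nn mulr1.
  transitivity ((n0 * a) * ((n0 * a) * t00 + 2 * (n1 * a) * t01) + n1 ^+ 2 * a * (a * t11)).
    by ring.
  have -> : n0 * a = - (n1 * b) by apply/eqP; rewrite -addr_eq0 nt.
  have -> : a * t11 = 2 * b * t01 - c * t00.
    by apply/eqP; rewrite -subr_eq0 -tr; apply/eqP; ring.
  transitivity (n1 ^+ 2 * (b ^+ 2 - a * c) * t00); first by ring.
  have -> : a * (a * (- (t00 / a) * ((n0 * b + n1 * c) * n1))) =
    - t00 * n1 * ((n0 * a) * b + a * n1 * c).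
    by field.
  have -> : n0 * a = - (n1 * b) by apply/eqP; rewrite -addr_eq0 nt.
  ring.
rewrite -ns -nu.
transitivity (2 * W * (p * (n0 * t00 + n1 * t01)
   + chi * (n0 ^+ 2 * t00 + 2 * n0 * n1 * t01 + n1 ^+ 2 * t11))
   + Q * W1 * (n0 * u0 + n1 * u1)); first by rewrite -nu; ring.
by rewrite K nu; ring.
Qed.

(** Since [p != 0], the vanishing tangential derivative of P can be solved for [t00]. Substitution
    turns the normal derivative into 2 Q W (h' - kappa + (log w)' h), written as a sum of two
    nonpositive parts. *)
Fact boundary_generic (R : realFieldType) (a t00 p chi kap H1 W W1 Q : R) :
  0 < a -> p != 0 -> Q = a * p ^+ 2 + chi ^+ 2 -> 0 < W -> 1 <= kap ->
  H1 * W + W1 * chi <= W ->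
  2 * (p * t00 + chi * ((H1 - kap) * (a * p))) * W + Q * (W1 * (a * p)) = 0 ->
  2 * W * (p * ((H1 - kap) * (a * p)) - chi * t00 / a) + Q * W1 * chi <= 0.
Proof.
move=> a0 p0 QE W0 k1 Hc P0.
have T : 2 * W * t00 = - (2 * W * chi * (H1 - kap) * a + Q * W1 * a).
  apply: (mulfI p0); apply/eqP; rewrite -subr_eq0 -P0; apply/eqP; ring.
have -> : 2 * W * (p * ((H1 - kap) * (a * p)) - chi * t00 / a) + Q * W1 * chi =
  2 * Q * ((H1 * W + W1 * chi - W) + (1 - kap) * W).
  transitivity (2 * W * (H1 - kap) * (a * p ^+ 2) - chi / a * (2 * W * t00) + Q * W1 * chi).
    by ring.
  rewrite T; have -> : a * p ^+ 2 = Q - chi ^+ 2 by rewrite QE addrK.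
  by field; rewrite gt_eqF.
have Q0 : 0 <= Q by rewrite QE addr_ge0 ?sqr_ge0// mulr_ge0 ?sqr_ge0// ltW.
apply: mulr_ge0_le0; first by rewrite mulr_ge0.
by rewrite -[0]addr0 lerD// ?subr_le0// mulr_le0_ge0 ?subr_le0// ltW.
Qed.

(* With [z = - chi * u00 / a], the hypothesis on the second tangential derivative
   confines [2 W z] between [0] and its value in the nondegenerate case. *)
Fact boundary_degenerate (R : realFieldType) (a u00 chi kap H1 W W1 : R) :
  0 < a -> 0 < W -> 1 <= kap -> H1 * W + W1 * chi <= W -> W1 * chi <= 2 * W ->
  u00 * ((2 * u00 / a + 2 * chi * H1) * W + chi ^+ 2 * W1) <= 0 ->
  2 * W * (0 - chi * (u00 + a * kap * chi) / a) + chi ^+ 2 * W1 * chi <= 0.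
Proof.
move=> a0 W0 k1 Hc Hd D2.
pose z := - chi * u00 / a.
have -> : 2 * W * (0 - chi * (u00 + a * kap * chi) / a) + chi ^+ 2 * W1 * chi =
   2 * W * z + chi ^+ 2 * (W1 * chi - 2 * W * kap).
  by rewrite /z; field; rewrite gt_eqF.
have zz : z * (2 * W * z - chi ^+ 2 * (2 * H1 * W + chi * W1)) <= 0.
  have -> : z * (2 * W * z - chi ^+ 2 * (2 * H1 * W + chi * W1)) =
    chi ^+ 2 / a * (u00 * ((2 * u00 / a + 2 * chi * H1) * W + chi ^+ 2 * W1)).
    by rewrite /z; field; rewrite gt_eqF.
  by rewrite mulr_ge0_le0// divr_ge0 ?sqr_ge0// ltW.
have Wk : W <= W * kap by rewrite ler_peMr// ltW.
(* Each end of the interval uses one bound: [Hd] together with [1 <= kap] at 0, and [Hc] at the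
   other end. *)
have [z0|z0] := leP z 0.
  have : 2 * W * z <= 0 by rewrite mulr_ge0_le0// mulr_ge0// ltW.
  have : chi ^+ 2 * (W1 * chi - 2 * W * kap) <= 0.
    by rewrite mulr_ge0_le0 ?sqr_ge0//; lra.
  lra.
have z1 : 2 * W * z <= chi ^+ 2 * (2 * H1 * W + chi * W1).
  by rewrite -subr_le0 -(pmulr_rle0 _ z0).
have : chi ^+ 2 * (2 * (H1 * W + W1 * chi - W) + 2 * (W - W * kap)) <= 0.
  by rewrite mulr_ge0_le0 ?sqr_ge0//; lra.
have -> : chi ^+ 2 * (2 * (H1 * W + W1 * chi - W) + 2 * (W - W * kap)) =
  chi ^+ 2 * (2 * H1 * W + chi * W1) + chi ^+ 2 * (W1 * chi - 2 * W * kap) by ring.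
lra.
Qed.

Fact orthonormal_coords (R : realFieldType) (a b c n0 n1 V0 V1 u0 chi : R) :
  a != 0 -> n0 * a + n1 * b = 0 -> (n0 * a + n1 * b) * n0 + (n0 * b + n1 * c) * n1 = 1 ->
  V0 * a + V1 * b = u0 -> (V0 * a + V1 * b) * n0 + (V0 * b + V1 * c) * n1 = chi ->
  [/\ V0 = u0 / a + chi * n0, V1 = chi * n1 &
   (V0 * a + V1 * b) * V0 + (V0 * b + V1 * c) * V1 = u0 ^+ 2 / a + chi ^+ 2].
Proof.
move=> a0 nt nn <-.
pose X1 := V1 - chi * n1; rewrite nt mul0r add0r in nn.
have n10 : n1 != 0 by apply/eqP => n10; move/eqP: nn; rewrite n10 mulr0 eq_sym oner_eq0.
have n0E : n0 = - (n1 * b) / a by apply: (mulIf a0); rewrite divfK//; apply/eqP; rewrite -addr_eq0 nt.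
(* Both sides are the squared area spanned by e_0 and the unit normal. *)
have d0 : (a * c - b ^+ 2) * n1 ^+ 2 = a.
  transitivity (a * ((n0 * b + n1 * c) * n1)); last by rewrite nn mulr1.
  by rewrite n0E; field.
have d1 : a * c - b ^+ 2 != 0.
  by apply/eqP => d1; move/eqP: d0; rewrite d1 mul0r eq_sym (negbTE a0).
move=> chiE.
have V1E : V1 = chi * n1.
  apply: (mulfI d1); transitivity (a * (V1 * (a * c - b ^+ 2) / a)); first by field.
  have -> : V1 * (a * c - b ^+ 2) / a = chi * n1 * (a * c - b ^+ 2) / a.
    rewrite -chiE n0E.
    have -> : ((V0 * a + V1 * b) * (- (n1 * b) / a) + (V0 * b + V1 * c) * n1) * n1 * (a * c - b ^+ 2) / a =
      V1 * ((a * c - b ^+ 2) * n1 ^+ 2) * (a * c - b ^+ 2) / (a * a) by field.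
    by rewrite d0; field.
  by field.
have V0E : V0 = (V0 * a + V1 * b) / a + chi * n0.
  have -> : chi * n0 = - (V1 * b) / a by rewrite V1E n0E; field.
  by field.
split=> //.
transitivity (V0 * (V0 * a + V1 * b) + (V0 * b + V1 * c) * V1); first by ring.
rewrite {1}V0E V1E.
transitivity ((V0 * a + chi * n1 * b) ^+ 2 / a + chi * ((V0 * a + V1 * b) * n0 + (V0 * b + V1 * c) * n1)).
  by rewrite V1E; field.
by rewrite chiE expr2.
Qed.

(** * The outer unit normal and the geodesic curvature *)

Section outer_normal_field.
Variables (R : realType) (U0 D : set (plane R)) (g : plane R -> 'M[R]_2).
Hypothesis gH : metric_on U0 D g.

Let U0_open : open U0 := dom_open gH.
Let DE : D = U0 `&` @half_plane R := dom_half gH.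

Local Notation e i := (@coord_field R i).
Local Notation N i := (nabla g (e i)).
Local Notation nu := (outer_normal g).

Lemma grad_coord k x : D x -> grad g (fun y => y 0 1) x 0 k = invmx (g x) k 1.
Proof.
move=> Dx; rewrite /grad mxE sum2 !(pderiv_coord DE)//=.
by rewrite mulr0 mulr1 add0r.
Qed.

Lemma inner_gradl f x w : D x ->
  inner g x (grad g f x) w = w 0 0 * pderiv 0 f x + w 0 1 * pderiv 1 f x.
Proof.
move=> Dx; rewrite -(inner_grad_e gH f 0 Dx) -(inner_grad_e gH f 1 Dx).
by rewrite !inner_e innerE; ring.
Qed.

Lemma norm_grad_coord x : D x ->
  inner g x (grad g (fun y => y 0 1) x) (grad g (fun y => y 0 1) x) =
  invmx (g x) 1 1.
Proof.
move=> Dx; rewrite inner_gradl// !(pderiv_coord DE)//= mulr0 mulr1 add0r.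
exact: grad_coord.
Qed.

Lemma invmx11_gt0 x : D x -> 0 < invmx (g x) 1 1.
Proof.
move=> Dx; have d0 := det_gt0 gH Dx.
have [_ _ _ ->] := invmx2E (lt0r_neq0 d0).
by rewrite divr_gt0// (g00_gt0 gH).
Qed.

Lemma outer_normalE k x : D x ->
  nu x 0 k = - ((Num.sqrt (invmx (g x) 1 1))^-1 * invmx (g x) k 1).
Proof.
by move=> Dx; rewrite /outer_normal norm_grad_coord// mxE [X in - X]mxE grad_coord.
Qed.

(** The inverse square root is the power with exponent -1/2 of a positive smooth function. *)
Lemma smooth_outer_normal : smooth_field D nu.
Proof.
move=> k; apply: (@smooth_eq _ _ (fun x =>
  - (invmx (g x) 1 1 `^ (- 2^-1) * invmx (g x) k 1))).
  move=> x /set_mem Dx; rewrite outer_normalE// powRN powR12_sqrt//.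
  exact: ltW (invmx11_gt0 Dx).
apply: smoothN; apply: smoothM; last exact: (smooth_inv gH).
apply: smooth_powR; last exact: (smooth_inv gH).
by move=> x /set_mem Dx; exact: invmx11_gt0.
Qed.

Lemma normal_derivativeE f x : D x ->
  normal_derivative g f x = inner g x (grad g f x) (nu x).
Proof. by move=> Dx; rewrite inner_gradl// /normal_derivative sum2. Qed.

Lemma inner_normal_e0 x : D x -> inner g x (nu x) (e 0 x) = 0.
Proof.
move=> Dx; have E := inner_grad_e gH (fun y => y 0 1) 0 Dx.
rewrite (pderiv_coord DE)//= in E.
rewrite /outer_normal; set r := (Num.sqrt _)^-1; rewrite -scaleNr.
rewrite (_ : inner g x (- r *: _) _ = - r * inner g x (grad g (fun y => y 0 1) x) (e 0 x)).
  by rewrite E mulr0.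
by move: (grad g _ x) => n; rewrite !innerE !mxE; ring.
Qed.

Lemma norm_outer_normal x : D x -> inner g x (nu x) (nu x) = 1.
Proof.
move=> Dx; have s0 := invmx11_gt0 Dx.
pose r := Num.sqrt (invmx (g x) 1 1).
have r0 : 0 < r by rewrite sqrtr_gt0.
have nuE : nu x = - r^-1 *: grad g (fun y => y 0 1) x.
  by rewrite /outer_normal norm_grad_coord// scaleNr.
have : inner g x (nu x) (nu x) = r^-1 ^+ 2 *
    inner g x (grad g (fun y => y 0 1) x) (grad g (fun y => y 0 1) x).
  by rewrite nuE; move: (grad g _ x) => n; rewrite !innerE !mxE; ring.
rewrite norm_grad_coord// => ->.
by rewrite -[X in _ * X]sqr_sqrtr ?ltW// -/r -exprMn mulVf ?expr1n// gt_eqF.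
Qed.

Lemma outer_normal1_lt0 x : D x -> nu x 0 1 < 0.
Proof.
move=> Dx; rewrite outer_normalE// oppr_lt0 mulr_gt0 ?invmx11_gt0//.
by rewrite invr_gt0 sqrtr_gt0 invmx11_gt0.
Qed.

Lemma nabla_normal_normal i x : D x -> inner g x (N i nu x) (nu x) = 0.
Proof.
move=> Dx; have E := inner_compat gH i smooth_outer_normal smooth_outer_normal Dx.
have : pderiv i (fun y => inner g y (nu y) (nu y)) x = 0.
  rewrite (@pderiv_eq _ _ _ U0_open DE _ (fun=> 1))//; first exact: (pderiv_cst DE).
  by move=> y /set_mem; exact: norm_outer_normal.
rewrite E [X in _ + X](innerC gH _ _ Dx) -mulr2n => /eqP.
by rewrite mulrn_eq0 /= => /eqP.
Qed.

Lemma nabla_normal_e0 i x : D x ->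
  inner g x (N i nu x) (e 0 x) + inner g x (nu x) (N i (e 0) x) = 0.
Proof.
move=> Dx; rewrite -(inner_compat gH i smooth_outer_normal (@smooth_e _ _ 0) Dx).
rewrite (@pderiv_eq _ _ _ U0_open DE _ (fun=> 0))//; first exact: (pderiv_cst DE).
by move=> y /set_mem; exact: inner_normal_e0.
Qed.

(** The covariant derivative is linear over functions in its direction, so the unit tangent may be
    replaced by e_0 at the price of the factor [g x 0 0]. *)
Lemma geodesic_curvatureE x : D x ->
  geodesic_curvature g x * g x 0 0 = inner g x (N 0 nu x) (e 0 x).
Proof.
move=> Dx; have a0 := g00_gt0 gH Dx.
pose r := Num.sqrt (g x 0 0).
have r0 : 0 < r by rewrite sqrtr_gt0.
have t0 : unit_tangent g x 0 0 = r^-1.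
  by rewrite mxE innerE !bvecE /= !mulr0 !mulr1 !addr0 mul1r mul0r addr0.
have t1 : unit_tangent g x 0 1 = 0 by rewrite mxE bvecE mulr0.
rewrite /geodesic_curvature nabla_expand t0 t1 scale0r addr0.
have -> : unit_tangent g x = r^-1 *: e 0 x.
  apply: plane_eqP; first by rewrite t0 mxE coord_fieldE mulr1.
  by rewrite t1 mxE coord_fieldE mulr0.
move: (N 0 nu x) (e 0 x) => z w.
have -> : inner g x (r^-1 *: z) (r^-1 *: w) = r^-1 ^+ 2 * inner g x z w.
  by rewrite !innerE !mxE; ring.
have <- : r ^+ 2 = g x 0 0 by rewrite sqr_sqrtr// ltW.
by field; rewrite gt_eqF.
Qed.

End outer_normal_field.

(** * The P-function along the boundary *)

Section boundary_maximum.
Variables (R : realType) (U0 D : set (plane R)) (g : plane R -> 'M[R]_2).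
Hypothesis gH : metric_on U0 D g.

Let U0_open : open U0 := dom_open gH.
Let DE : D = U0 `&` @half_plane R := dom_half gH.

Local Notation e i := (@coord_field R i).
Local Notation N i := (nabla g (e i)).
Local Notation nu := (outer_normal g).

Variable u : plane R -> R.
Hypothesis u_smooth : smooth_on D u.
Hypothesis u_harm : forall x, D x -> laplace_beltrami g u x = 0.

Local Notation V := (grad g u).
Local Notation A i := (N i V).
Local Notation Q := (grad_sq g u).

Variables W W1 H H1 : plane R -> R.
Hypothesis W_smooth : smooth_on D W.
Hypothesis W1_smooth : smooth_on D W1.
Hypothesis H_smooth : smooth_on D H.
Hypothesis H1_smooth : smooth_on D H1.
Hypothesis dW : forall i x, D x -> pderiv i W x = W1 x * pderiv i u x.
Hypothesis dH : forall i x, D x -> pderiv i H x = H1 x * pderiv i u x.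
Hypothesis u_line : forall x, D x -> x 0 1 = 0 -> normal_derivative g u x = H x.

Local Notation P := (fun x => Q x * W x).
Local Notation u_ i := (pderiv i u).

Lemma normal_coords x : D x ->
  [/\ V x 0 0 = u_ 0 x / g x 0 0 + normal_derivative g u x * nu x 0 0,
      V x 0 1 = normal_derivative g u x * nu x 0 1 &
      Q x = u_ 0 x ^+ 2 / g x 0 0 + normal_derivative g u x ^+ 2].
Proof.
move=> Dx; have a0 := g00_gt0 gH Dx.
have nt := inner_normal_e0 gH Dx; have nn := norm_outer_normal gH Dx.
have Ve := inner_grad_e gH u 0 Dx; have Vn := esym (normal_derivativeE gH u Dx).
have e00 := coord_fieldE 0 0 x; have e01 := coord_fieldE 0 1 x.
rewrite /= in e00 e01.
have gE := g10 gH Dx; rewrite /grad_sq.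
rewrite !innerE gE ?e00 ?e01 !mulr1 !mulr0 !addr0 in nt nn Ve Vn *.
exact: orthonormal_coords (lt0r_neq0 a0) nt nn Ve Vn.
Qed.

(** The condition u_nu = h(u) is differentiated along the boundary. On the left, the derivative of
    the normal is tangential, because the normal has unit length, and contributes the geodesic
    curvature. *)
Lemma tangential_derivative_normal x : D x -> x 0 1 = 0 ->
  inner g x (A 0 x) (nu x) = (H1 x - geodesic_curvature g x) * u_ 0 x.
Proof.
move=> Dx x1.
have sV := smooth_grad gH u_smooth.
have C := inner_compat gH 0 sV (smooth_outer_normal gH) Dx.
have : pderiv 0 (fun y => inner g y (V y) (nu y)) x = H1 x * u_ 0 x.
  rewrite -dH//; apply: (pderiv0_eq_line U0_open DE) => // y Dy y1.
  by rewrite -(normal_derivativeE gH u Dy) u_line.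
rewrite C => E.
suff Z : inner g x (V x) (N 0 nu x) = geodesic_curvature g x * u_ 0 x.
  by rewrite Z in E; rewrite mulrBl -E addrK.
have [V0 V1 _] := normal_coords Dx.
have a0 := g00_gt0 gH Dx.
have K := geodesic_curvatureE gH Dx; have Zn := nabla_normal_normal gH 0 Dx.
have -> : inner g x (V x) (N 0 nu x) =
   u_ 0 x / g x 0 0 * inner g x (N 0 nu x) (e 0 x)
   + normal_derivative g u x * inner g x (N 0 nu x) (nu x).
  have e00 := coord_fieldE 0 0 x; have e01 := coord_fieldE 0 1 x.
  rewrite /= in e00 e01.
  rewrite !innerE V0 V1 (g10 gH Dx) e00 e01.
  move: (N 0 nu x) => z; move: (nu x) (normal_derivative g u x) (u_ 0 x / g x 0 0) => n chi p.
  ring.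
rewrite Zn -K mulr0 addr0; move: (geodesic_curvature g x) (u_ 0 x) => k p.
by field; rewrite gt_eqF.
Qed.

Lemma trace_A_inner x : D x ->
  g x 1 1 * inner g x (A 0 x) (e 0 x)
  - g x 0 1 * (inner g x (A 0 x) (e 1 x) + inner g x (A 0 x) (e 1 x))
  + g x 0 0 * inner g x (A 1 x) (e 1 x) = 0.
Proof.
move=> Dx; rewrite {2}(A_sym gH u_smooth Dx).
have T : A 0 x 0 0 + A 1 x 0 1 = 0 := trace_A u_harm Dx.
rewrite !inner_e (g10 gH Dx); move: T.
move: (A 0 x) (A 1 x) => z w T.
transitivity ((g x 0 0 * g x 1 1 - g x 0 1 ^+ 2) * (z 0 0 + w 0 1)); first by ring.
by rewrite T mulr0.
Qed.

Lemma conormal_derivative_P x : D x -> x 0 1 = 0 ->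
  let p := u_ 0 x / g x 0 0 in
  nu x 0 0 * pderiv 0 P x + nu x 0 1 * pderiv 1 P x =
  2 * W x * (p * ((H1 x - geodesic_curvature g x) * (g x 0 0 * p))
     - H x * inner g x (A 0 x) (e 0 x) / g x 0 0) + Q x * W1 x * H x.
Proof.
move=> Dx x1 p; have a0 := g00_gt0 gH Dx.
have pE : g x 0 0 * p = u_ 0 x by rewrite /p mulrC divfK// gt_eqF.
rewrite pE -(tangential_derivative_normal Dx x1).
rewrite (pderiv_P gH u_smooth W_smooth dW 0 Dx) (pderiv_P gH u_smooth W_smooth dW 1 Dx).
have [V0 V1 _] := normal_coords Dx; rewrite (u_line Dx x1) in V0 V1.
have nd : nu x 0 0 * u_ 0 x + nu x 0 1 * u_ 1 x = H x.
  by rewrite -(u_line Dx x1) /normal_derivative sum2.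
have nt := inner_normal_e0 gH Dx; have nn := norm_outer_normal gH Dx.
have tr := trace_A_inner Dx; have sy := A_sym gH u_smooth Dx.
have expand (z w : plane R) : inner g x z w =
    w 0 0 * inner g x z (e 0 x) + w 0 1 * inner g x z (e 1 x).
  by rewrite !inner_e innerE; ring.
rewrite (expand (A 0 x) (V x)) (expand (A 1 x) (V x)) (expand (A 0 x) (nu x)) -sy.
rewrite V0 V1 -/p.
have e00 := coord_fieldE 0 0 x; have e01 := coord_fieldE 0 1 x; rewrite /= in e00 e01.
rewrite innerE e00 e01 mulr1 mulr0 addr0 (g10 gH Dx) in nt.
rewrite innerE (g10 gH Dx) in nn.
exact: (conormal_derivative p (W x) (W1 x) (Q x) (lt0r_neq0 a0) nt nn tr erefl nd).
Qed.

(** On the boundary, |grad u|^2 is u_0^2 / g_00 + h(u)^2, so P equals [E] there. The tangential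
    derivative of [E] has the factor u_0, hence where u_0 vanishes only the derivative of that
    factor survives in the second derivative. *)
Lemma tangential_second_derivative x : D x -> x 0 1 = 0 -> u_ 0 x = 0 ->
  pderiv 0 (pderiv 0 P) x = pderiv 0 (u_ 0) x *
    ((2 * pderiv 0 (u_ 0) x / g x 0 0 + 2 * H x * H1 x) * W x + H x ^+ 2 * W1 x).
Proof.
move=> Dx x1 u0x.
pose ai y := g y 0 0 `^ (-1).
have gpos : {in D, forall y, 0 < g y 0 0} by move=> y /set_mem; exact: (g00_gt0 gH).
have s_ai : smooth_on D ai by apply: smooth_powR => //; exact: (g_smooth gH).
have aiE y : D y -> ai y = (g y 0 0)^-1.
  by move=> Dy; rewrite /ai powR_inv1// ltW// (g00_gt0 gH).
have s0 : smooth_on D (u_ 0) := smooth_pderiv U0_open DE 0 u_smooth.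
have s00 : smooth_on D (pderiv 0 (u_ 0)) := smooth_pderiv U0_open DE 0 s0.
have sdai : smooth_on D (pderiv 0 ai) := smooth_pderiv U0_open DE 0 s_ai.
have s1 := smoothM s0 s0; have s2 := smoothM s1 s_ai; have s3 := smoothM H_smooth H_smooth.
have s4 := smoothD s2 s3.
pose E y := (u_ 0 y * u_ 0 y * ai y + H y * H y) * W y.
pose G y := (2 * (pderiv 0 (u_ 0) y * ai y) + u_ 0 y * pderiv 0 ai y + 2 * (H y * H1 y)) * W y
  + (u_ 0 y * u_ 0 y * ai y + H y * H y) * W1 y.
have sE : smooth_on D E := smoothM s4 W_smooth.
have sG : smooth_on D G.
  apply: smoothD; last exact: smoothM s4 W1_smooth.
  apply: smoothM; last exact: W_smooth.
  apply: smoothD; last by apply: smoothM; [exact: smooth_cst|exact: smoothM].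
  apply: smoothD; last exact: smoothM.
  by apply: smoothM; [exact: smooth_cst|exact: smoothM].
have PE y : D y -> y 0 1 = 0 -> P y = E y.
  move=> Dy y1; have [_ _ ->] := normal_coords Dy; rewrite (u_line Dy y1) /E (aiE _ Dy).
  by rewrite !expr2.
have dE y : D y -> pderiv 0 E y = u_ 0 y * G y.
  move=> Dy; rewrite /E (pderivM U0_open DE 0 s4 W_smooth Dy) (dW 0 Dy).
  rewrite (pderivD U0_open DE 0 s2 s3 Dy) (pderivM U0_open DE 0 s1 s_ai Dy).
  rewrite (pderivM U0_open DE 0 s0 s0 Dy) (pderivM U0_open DE 0 H_smooth H_smooth Dy) (dH 0 Dy).
  rewrite /G; move: (pderiv 0 (u_ 0) y) (pderiv 0 ai y) (u_ 0 y) (ai y) => p q r t.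
  ring.
have dP y : D y -> y 0 1 = 0 -> pderiv 0 P y = u_ 0 y * G y.
  by move=> Dy y1; rewrite -(dE y Dy); exact: (pderiv0_eq_line U0_open DE).
rewrite (pderiv0_eq_line U0_open DE dP Dx x1).
rewrite (pderivM U0_open DE 0 s0 sG Dx) u0x mul0r addr0.
rewrite /G u0x (aiE _ Dx).
move: (pderiv 0 (u_ 0) x) (pderiv 0 ai x) => p q.
by rewrite !mul0r add0r addr0 !mulrA !expr2; congr (_ * _); ring.
Qed.

Lemma boundary_max_critical x : D x -> x 0 1 = 0 -> (forall y, D y -> P y <= P x) ->
  0 < W x -> 1 <= geodesic_curvature g x ->
  H1 x * W x + W1 x * H x <= W x -> W1 x * H x <= 2 * W x ->
  pderiv 0 P x = 0 /\ pderiv 1 P x = 0.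
Proof.
move=> Dx x1 Pmax W0 k1 Hc Hd; have a0 := g00_gt0 gH Dx.
have sP : smooth_on D P := smooth_P gH u_smooth W_smooth.
have PM (v : plane R) := @pderiv_max _ _ _ U0_open DE P x v sP Dx Pmax.
(* Both e_0 and its opposite are tangential, so the one-sided test applies to each. *)
have P0 : pderiv 0 P x = 0.
  have [|L _] := PM (bvec R 0); first by left; rewrite bvecE.
  have [|L' _] := PM (- bvec R 0); first by left; rewrite mxE bvecE oppr0.
  move: L L'; rewrite !mxE /= oppr0 !mul0r !addr0 mul1r mulN1r oppr_le0 => L L'.
  by apply/eqP; rewrite eq_le L.
split=> //.
have P1 : pderiv 1 P x <= 0.
  have [|L _] := PM (bvec R 1); first by left; rewrite bvecE.
  by move: L; rewrite !mxE /= mul0r add0r mul1r.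
apply/eqP; rewrite eq_le P1 /=.
(* The outer normal has negative second component and the tangential derivative of P is 0, so the
   missing inequality amounts to a nonpositive normal derivative. *)
rewrite -(nmulr_rle0 _ (outer_normal1_lt0 gH Dx)).
have C := conormal_derivative_P Dx x1; rewrite /= P0 mulr0 add0r in C; rewrite C.
have [_ _ QE] := normal_coords Dx; rewrite (u_line Dx x1) in QE.
have [u0x|u0x] := eqVneq (u_ 0 x) 0.
  have D2 : pderiv 0 (pderiv 0 P) x <= 0.
    have [|_ L] := PM (bvec R 0); first by left; rewrite bvecE.
    move: L; rewrite P0 !mulr0 add0r bvecE /= mul0r => /(_ erefl).
    by rewrite bvecE /= expr1n expr0n /= mul1r mulr0 !mul0r !addr0.
  rewrite (tangential_second_derivative Dx x1 u0x) in D2.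
  (* As u_0 vanishes, grad u is normal at [x], and the correction between the second partial
     derivative and the Hessian is the second fundamental form times h(u). *)
  have t00 : inner g x (A 0 x) (e 0 x) =
      pderiv 0 (u_ 0) x + g x 0 0 * geodesic_curvature g x * H x.
    have U := pderiv2_u gH u_smooth 0 0 Dx.
    have [V0 V1 _] := normal_coords Dx; rewrite (u_line Dx x1) u0x mul0r add0r in V0 V1.
    have Z := nabla_normal_e0 gH 0 Dx; rewrite -(geodesic_curvatureE gH Dx) in Z.
    have VE : inner g x (V x) (N 0 (e 0) x) = H x * inner g x (nu x) (N 0 (e 0) x).
      by rewrite !innerE V0 V1; move: (N 0 (e 0) x) (nu x) => z n; ring.
    rewrite U VE; move: Z; set k := geodesic_curvature g x; set s := inner g x (nu x) _.
    by move=> Z; have -> : s = - (k * g x 0 0); [apply/eqP; rewrite -addr_eq0 addrC Z|ring].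
  rewrite u0x mul0r mulr0 mulr0 mul0r t00 QE u0x expr0n /= mul0r [0 + H x ^+ 2]add0r.
  exact: (boundary_degenerate a0 W0 k1 Hc Hd D2).
have p0 : u_ 0 x / g x 0 0 != 0 by rewrite mulf_neq0// invr_neq0// gt_eqF.
have QE' : Q x = g x 0 0 * (u_ 0 x / g x 0 0) ^+ 2 + H x ^+ 2.
  by rewrite QE; move: (u_ 0 x) => t; field; rewrite gt_eqF.
apply: (boundary_generic a0 p0 QE' W0 k1 Hc).
move: P0; rewrite (pderiv_P gH u_smooth W_smooth dW 0 Dx) => P0.
have pE : g x 0 0 * (u_ 0 x / g x 0 0) = u_ 0 x.
  rewrite mulrC divfK; first by [].
  exact: (lt0r_neq0 a0).
rewrite pE -(tangential_derivative_normal Dx x1) -[RHS]P0.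
have [V0 V1 _] := normal_coords Dx; rewrite (u_line Dx x1) in V0 V1.
congr (2 * _ * _ + _).
have e00 := coord_fieldE 0 0 x; have e01 := coord_fieldE 0 1 x; rewrite /= in e00 e01.
rewrite !innerE V0 V1 e00 e01.
move: (A 0 x) (nu x) (u_ 0 x / g x 0 0) (H x) => z n p chi; ring.
Qed.

End boundary_maximum.

(** * The maximum of the P-function in a chart *)

Section scalar_inequalities.
Variables (R : realType) (q lambda : R).
Hypotheses (q_gt1 : 1 < q) (lambda_gt0 : 0 < lambda) (lambda_le : lambda <= (q - 1)^-1).

(* The positive zero of [x `^ q - lambda * x]. *)
Definition root_value : R := lambda `^ (q - 1)^-1.
Local Notation s0 := root_value.

Let q1 : 0 < q - 1. Proof. by rewrite subr_gt0. Qed.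
Let q0 : 0 < q. Proof. exact: lt_trans ltr01 q_gt1. Qed.

Lemma root_value_gt0 : 0 < s0. Proof. exact: powR_gt0. Qed.

Lemma root_valueX : s0 `^ (q - 1) = lambda.
Proof. by rewrite /root_value -powRrM mulVf ?powRr1 ?gt_eqF// ltW. Qed.

Lemma lambda_q_le1 : lambda * (q - 1) <= 1.
Proof. by rewrite -ler_pdivlMr// mul1r. Qed.

Lemma powR_split x : 0 < x -> x `^ q = x * x `^ (q - 1).
Proof.
by move=> x0; rewrite (mulr_powRB1 (ltW x0) q0).
Qed.

(** Both factors vanish at the root and change sign there in opposite senses. *)
Lemma powR_monotone x : 0 < x -> (x `^ (q - 1) - lambda) * (s0 - x) <= 0.
Proof.
move=> x0; have s00 := root_value_gt0; rewrite -root_valueX.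
have [xs|sx] := leP x s0.
  rewrite mulr_le0_ge0 ?subr_ge0// subr_le0.
  by apply: (ge0_ler_powR (ltW q1)); rewrite ?nnegrE ?(ltW x0) ?(ltW s00).
rewrite mulr_ge0_le0 ?subr_le0 ?(ltW sx)// subr_ge0.
by apply: (ge0_ler_powR (ltW q1)); rewrite ?nnegrE ?(ltW x0) ?(ltW s00) ?(ltW sx).
Qed.

(** This is h' + (log w)' h <= 1 multiplied by x + s0. By [E] the left side is a nonpositive
    multiple of [powR_monotone] plus lambda (q - 1) (x + s0). *)
Lemma robin_slope x : 0 < x ->
  (q * x `^ (q - 1) - lambda) * (x + s0) - 2 * q * (x `^ q - lambda * x) <= x + s0.
Proof.
move=> x0; have s00 := root_value_gt0; have M := powR_monotone x0.
rewrite (powR_split x0); set t := x `^ (q - 1) in M *.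
have E : (q * t - lambda) * (x + s0) - 2 * q * (x * t - lambda * x) =
   q * ((t - lambda) * (s0 - x)) + lambda * (q - 1) * (x + s0) by ring.
rewrite E -[leRHS]add0r lerD//; first exact: mulr_ge0_le0 (ltW q0) M.
by rewrite ler_piMl ?lambda_q_le1// ltW// addr_gt0.
Qed.

(** Young's inequality for the product of [x] and [lambda] with exponents q and q / (q - 1); the
    corresponding power of [lambda] is lambda s0. *)
Lemma robin_young x : 0 < x -> q * (lambda * x) <= x `^ q + (q - 1) * (lambda * s0).
Proof.
move=> x0; have s00 := root_value_gt0.
have p0 : 0 < q / (q - 1) by rewrite divr_gt0.
have pq : q^-1 + (q / (q - 1))^-1 = 1.
  by field; rewrite !gt_eqF.
have := conjugate_powR (ltW x0) (ltW lambda_gt0) q0 p0 pq.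
have -> : lambda `^ (q / (q - 1)) = lambda * s0.
  by rewrite mulrC powRrM -/root_value powR_split// root_valueX mulrC.
move=> /(ler_wpM2l (ltW q0)); rewrite [x * _]mulrC.
move: (x `^ q) => X.
have -> // : q * (X / q + lambda * s0 / (q / (q - 1))) = X + (q - 1) * (lambda * s0).
by field; rewrite !gt_eqF.
Qed.

Lemma robin_lower x : 0 < x -> - (q * (x `^ q - lambda * x)) <= x + s0.
Proof.
move=> x0; have s00 := root_value_gt0; have L := lambda_q_le1; have Y := robin_young x0.
have [sx|xs] := leP s0 x.
  have : 0 <= x `^ q - lambda * x.
    rewrite powR_split// mulrC -mulrBl mulr_ge0 ?(ltW x0)// subr_ge0 -root_valueX.
    by apply: (ge0_ler_powR (ltW q1)); rewrite ?nnegrE ?(ltW x0) ?(ltW s00).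
  move=> h0; have : 0 <= q * (x `^ q - lambda * x) by rewrite mulr_ge0// ltW.
  lra.
(* The threshold is where q (s0 - x) equals x + s0. *)
have [sx|sx] := leP (s0 * (q - 1)) (x * (q + 1)).
  have : q * (lambda * x - x `^ q) <= q * (s0 - x).
    rewrite ler_wpM2l ?(ltW q0)//.
    apply: (@le_trans _ _ (lambda * (q - 1) * (s0 - x))); first lra.
    by rewrite ler_piMl// subr_ge0 ltW.
  lra.
have : 0 <= x `^ q by exact: powR_ge0.
move=> xq; have : 0 <= q * x `^ q by rewrite mulr_ge0// ltW.
have : q * (lambda * x) <= x + s0.
  rewrite -(ler_pM2r q1).
  have -> : q * (lambda * x) * (q - 1) = (lambda * (q - 1)) * (q * x) by ring.
  apply: (@le_trans _ _ (q * x)); first by rewrite ler_piMl// mulr_ge0// ltW.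
  have : 0 < q * x by rewrite mulr_gt0.
  lra.
lra.
Qed.

End scalar_inequalities.

Definition p_function (R : realType) (g : plane R -> 'M[R]_2) (q lambda : R)
    (u : plane R -> R) (x : plane R) : R :=
  grad_sq g u x * (u x + root_value q lambda) `^ (- (2 * q)).

(** * Excluding a positive maximum inside one chart *)

Section local_maximum.
Variables (R : realType) (U0 D : set (plane R)) (g : plane R -> 'M[R]_2).
Hypothesis gH : metric_on U0 D g.
Variables (q lambda : R).
Hypotheses (q_gt1 : 1 < q) (lambda_gt0 : 0 < lambda) (lambda_le : lambda <= (q - 1)^-1).
Variable u : plane R -> R.
Hypothesis u_smooth : smooth_on D u.
Hypothesis u_gt0 : forall x, D x -> 0 < u x.
Hypothesis u_harm : forall x, D x -> laplace_beltrami g u x = 0.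
Hypothesis K_ge0 : forall x, D x -> 0 <= gauss_curvature g x.
Hypothesis kappa_ge1 : forall x, D x -> x 0 1 = 0 -> 1 <= geodesic_curvature g x.
Hypothesis u_robin : forall x, D x -> x 0 1 = 0 ->
  normal_derivative g u x + lambda * u x = u x `^ q.

Let U0_open : open U0 := dom_open gH.
Let DE : D = U0 `&` @half_plane R := dom_half gH.
Local Notation s0 := (root_value q lambda).

Let shift_gt0 : {in D, forall x, 0 < u x + s0}.
Proof. by move=> x /set_mem Dx; rewrite addr_gt0 ?root_value_gt0// u_gt0. Qed.

Let shift_smooth : smooth_on D (fun x => u x + s0).
Proof. by apply: smoothD => //; exact: smooth_cst. Qed.

Let pderiv_shift i x : D x -> pderiv i (fun y => u y + s0) x = pderiv i u x.
Proof.
move=> Dx; rewrite (pderivD U0_open DE)//; last exact: smooth_cst.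
by rewrite (pderiv_cst DE)// addr0.
Qed.

Let u_pos : {in D, forall x, 0 < u x}.
Proof. by move=> x /set_mem; exact: u_gt0. Qed.

Lemma smooth_p_function : smooth_on D (p_function g q lambda u).
Proof. exact: (smooth_P gH u_smooth (smooth_powR _ shift_gt0 shift_smooth)). Qed.

Lemma p_function_max x : D x ->
  (forall y, D y -> p_function g q lambda u y <= p_function g q lambda u x) ->
  0 < grad_sq g u x -> False.
Proof.
move=> Dx Pmax Q0.
pose W y := (u y + s0) `^ (- (2 * q)).
pose W1 y := - (2 * q) * (u y + s0) `^ (- (2 * q) - 1).
pose W2 y := - (2 * q) * ((- (2 * q) - 1) * (u y + s0) `^ (- (2 * q) - 1 - 1)).
pose H y := u y `^ q - lambda * u y.
pose H1 y := q * u y `^ (q - 1) - lambda.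
have sp r : smooth_on D (fun y => (u y + s0) `^ r) by exact: smooth_powR.
have su r : smooth_on D (fun y => u y `^ r) by exact: smooth_powR.
have sW : smooth_on D W by exact: sp.
have sW1 : smooth_on D W1 by apply: smoothM => //; exact: smooth_cst.
have slu : smooth_on D (fun y => lambda * u y) by apply: smoothM => //; exact: smooth_cst.
have sH : smooth_on D H by apply: smoothB.
have sH1 : smooth_on D H1.
  apply: smoothB; last exact: smooth_cst.
  by apply: smoothM => //; exact: smooth_cst.
have dW i y : D y -> pderiv i W y = W1 y * pderiv i u y.
  by move=> Dy; rewrite (pderiv_powR U0_open DE)// pderiv_shift.
have dW1 i y : D y -> pderiv i W1 y = W2 y * pderiv i u y.
  move=> Dy; rewrite /W1 (pderivZ U0_open DE)// (pderiv_powR U0_open DE)// pderiv_shift//.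
  by rewrite /W2 !mulrA.
have dH i y : D y -> pderiv i H y = H1 y * pderiv i u y.
  move=> Dy; rewrite /H (pderivB U0_open DE)// (pderiv_powR U0_open DE)// (pderivZ U0_open DE)//.
  by rewrite /H1 mulrBl.
have line y : D y -> y 0 1 = 0 -> normal_derivative g u y = H y.
  by move=> Dy y1; rewrite /H -u_robin// addrK.
have t0 := shift_gt0 (mem_set Dx).
have W0 : 0 < W x by exact: powR_gt0.
have W1E : W1 x = - (2 * q) * W x / (u x + s0).
  rewrite /W1 /W powRB; last by apply/implyP => _; rewrite gt_eqF.
  by rewrite powRr1 ?(ltW t0)// mulrA.
have W2E : W2 x = 2 * q * (2 * q + 1) * W x / (u x + s0) ^+ 2.
  rewrite /W2 /W powRB; last by apply/implyP => _; rewrite gt_eqF.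
  rewrite powRB; last by apply/implyP => _; rewrite gt_eqF.
  rewrite powRr1 ?(ltW t0)//; move: (_ `^ _) => w.
  by field; rewrite gt_eqF.
have q0 : 0 < q := lt_trans ltr01 q_gt1.
have crit : pderiv 0 (p_function g q lambda u) x = 0 /\
    pderiv 1 (p_function g q lambda u) x = 0.
  have [x1|x1] := eqVneq (x 0 1) 0.
    apply: (boundary_max_critical gH u_smooth u_harm sW sW1 sH sH1 dW dH line Dx x1 Pmax W0).
    - exact: kappa_ge1.
    - rewrite W1E -(ler_pM2r t0) /H1 /H.
      have := robin_slope q_gt1 lambda_gt0 lambda_le (u_gt0 Dx).
      move/(ler_wpM2l (ltW W0)).
      move: (u x `^ q) (u x `^ (q - 1)) (W x) => X Y w; apply: le_trans.
      rewrite le_eqVlt; apply/orP; left; apply/eqP.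
      by field; rewrite gt_eqF.
    - rewrite W1E -(ler_pM2r t0) /H.
      have := robin_lower q_gt1 lambda_gt0 lambda_le (u_gt0 Dx).
      have W20 : 0 <= 2 * W x by rewrite mulr_ge0// ltW.
      move/(ler_wpM2l W20); move: (u x `^ q) (W x) => X w; apply: le_trans.
      rewrite le_eqVlt; apply/orP; left; apply/eqP.
      by field; rewrite gt_eqF.
  have x1' : 0 < x 0 1.
    by rewrite lt_neqAle eq_sym x1; have := D_half DE Dx.
  (* Off the boundary every direction is admissible, so the test on both signs of e_0 and e_1 kills
     the first derivatives. *)
  have PM (v : plane R) := (@pderiv_max _ _ _ U0_open DE _ x v smooth_p_function Dx Pmax
    (or_intror x1')).1.
  move: (pderiv 0 _ x) (pderiv 1 _ x) PM => p0 p1 PM.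
  have A0 := PM (bvec R 0); have A1 := PM (bvec R 1).
  have B0 := PM (- bvec R 0); have B1 := PM (- bvec R 1).
  move: A0 A1 B0 B1; rewrite !mxE /= !oppr0 !mul0r !addr0 !add0r !mul1r !mulN1r !oppr_le0.
  move=> A0 A1 B0 B1; split; apply/eqP; first by rewrite eq_le A0.
  by rewrite eq_le A1.
(* Strict log-convexity of the weight remains: up to the positive factor w^2 / (u + s0)^2 it is
   (2q)^2 < 2q (2q + 1). *)
apply: (no_critical_max gH u_smooth u_harm sW sW1 dW dW1 Dx Pmax crit.1 crit.2 (K_ge0 Dx) Q0 W0).
rewrite W1E W2E.
have -> : (- (2 * q) * W x / (u x + s0)) ^+ 2 =
  2 * q * (2 * q) * (W x ^+ 2 / (u x + s0) ^+ 2) by field; rewrite gt_eqF.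
have -> : W x * (2 * q * (2 * q + 1) * W x / (u x + s0) ^+ 2) =
  2 * q * (2 * q + 1) * (W x ^+ 2 / (u x + s0) ^+ 2) by field; rewrite gt_eqF.
by rewrite ltr_pM2r ?divr_gt0 ?exprn_gt0// ltr_pM2l ?mulr_gt0// ltrDl.
Qed.

End local_maximum.

(** * Change of charts *)

(** Numerator and denominator are both multiplied by the squared Jacobian determinant. That
    determinant is nonzero because the pulled-back metric is nondegenerate. *)
Fact dual_form_change (R : fieldType) (a b c a' b' c' j00 j01 j10 j11 p q : R) :
  a' = (j00 * a + j10 * b) * j00 + (j00 * b + j10 * c) * j10 ->
  b' = (j00 * a + j10 * b) * j01 + (j00 * b + j10 * c) * j11 ->
  c' = (j01 * a + j11 * b) * j01 + (j01 * b + j11 * c) * j11 ->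
  a' * c' - b' ^+ 2 != 0 ->
  let p' := p * j00 + q * j10 in let q' := p * j01 + q * j11 in
  (c' * p' ^+ 2 - 2 * b' * p' * q' + a' * q' ^+ 2) / (a' * c' - b' ^+ 2) =
  (c * p ^+ 2 - 2 * b * p * q + a * q ^+ 2) / (a * c - b ^+ 2).
Proof.
move=> -> -> -> d' p' q'; rewrite /p' /q'.
pose dJ := j00 * j11 - j01 * j10.
have dE : ((j00 * a + j10 * b) * j00 + (j00 * b + j10 * c) * j10) *
    ((j01 * a + j11 * b) * j01 + (j01 * b + j11 * c) * j11) -
    ((j00 * a + j10 * b) * j01 + (j00 * b + j10 * c) * j11) ^+ 2 =
    dJ ^+ 2 * (a * c - b ^+ 2) by rewrite /dJ; ring.
move: d'; rewrite dE mulf_eq0 negb_or => /andP[dJ0 d0].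
transitivity ((dJ ^+ 2 * (c * p ^+ 2 - 2 * b * p * q + a * q ^+ 2)) / (dJ ^+ 2 * (a * c - b ^+ 2))).
  by congr (_ / _); rewrite /dJ; ring.
by rewrite -mulf_div divff// mul1r.
Qed.

Section grad_sq_facts.
Variables (R : realType) (U0 D : set (plane R)) (g : plane R -> 'M[R]_2).
Hypothesis gH : metric_on U0 D g.
Variable u : plane R -> R.

Lemma grad_sqE x : D x -> grad_sq g u x =
  (g x 1 1 * pderiv 0 u x ^+ 2 - 2 * g x 0 1 * pderiv 0 u x * pderiv 1 u x
   + g x 0 0 * pderiv 1 u x ^+ 2) / (g x 0 0 * g x 1 1 - g x 0 1 ^+ 2).
Proof.
move=> Dx; have d0 := det_gt0 gH Dx.
rewrite /grad_sq (inner_gradl gH)// /grad !mxE !sum2.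
have [-> -> -> ->] := invmx2E (lt0r_neq0 d0).
rewrite (g10 gH Dx); rewrite (detD gH Dx) in d0 *.
by move: (pderiv 0 u x) (pderiv 1 u x) => p q; field; rewrite gt_eqF.
Qed.

Lemma grad_sq_eq0 x i : D x -> grad_sq g u x <= 0 -> pderiv i u x = 0.
Proof.
move=> Dx; have [V0 _|V0] := eqVneq (grad g u x) 0; last first.
  by rewrite leNgt /grad_sq /inner (g_pos gH Dx V0).
by rewrite -(inner_grad_e gH u i Dx) V0 innerE !mxE !mul0r addr0 !mul0r addr0.
Qed.

End grad_sq_facts.

(** * Chain rule and transition maps *)

Section chain_rule.
Variable R : realType.

Lemma derive_comp_plane (T0 T1 F : plane R -> R) (V W : set (plane R)) x i :
  let T y : plane R := T0 y *: bvec R 0 + T1 y *: bvec R 1 in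
  open V -> V x -> Cn 1 V T0 -> Cn 1 V T1 ->
  open W -> W (T x) -> Cn 1 W F ->
  is_derive x (bvec R i) (F \o T)
    (\sum_(k < 2) 'D_(bvec R k) F (T x) * 'D_(bvec R i) (if k == 0 then T0 else T1) x).
Proof.
move=> T oV Vx C0 C1 oW WT CF.
have [d0 E0] := Cn1_diff oV Vx C0; have [d1 E1] := Cn1_diff oV Vx C1.
have [dF EF] := Cn1_diff oW WT CF.
have dT0 : differentiable (fun y => T0 y *: bvec R 0) x by exact: differentiableZl.
have dT1 : differentiable (fun y => T1 y *: bvec R 1) x by exact: differentiableZl.
have dT : differentiable T x by exact: differentiableD.
have dFT : differentiable (F \o T) x by exact: differentiable_comp.
split; first exact: diff_derivable.
rewrite deriveE// diff_comp// /comp EF.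
have D0 : 'd (fun y => T0 y *: bvec R 0) x (bvec R i) = 'd T0 x (bvec R i) *: bvec R 0 :=
  congr1 (fun f : plane R -> plane R => f (bvec R i)) (diffZl (bvec R 0) d0).
have D1 : 'd (fun y => T1 y *: bvec R 1) x (bvec R i) = 'd T1 x (bvec R i) *: bvec R 1 :=
  congr1 (fun f : plane R -> plane R => f (bvec R i)) (diffZl (bvec R 1) d1).
have ED : 'd T x (bvec R i) = 'd (fun y => T0 y *: bvec R 0) x (bvec R i)
    + 'd (fun y => T1 y *: bvec R 1) x (bvec R i) :=
  congr1 (fun f : plane R -> plane R => f (bvec R i)) (diffD dT0 dT1).
apply: (etrans (congr1 (coord_form _ _) (etrans ED (congr2 +%R D0 D1)))).
have E0i := deriveE (bvec R i) d0.
have E1i := deriveE (bvec R i) d1.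
apply: (etrans (congr1 (coord_form _ _) (congr2 +%R
  (congr1 ( *:%R^~ (bvec R 0)) (esym E0i)) (congr1 ( *:%R^~ (bvec R 1)) (esym E1i))))).
rewrite sum2 /coord_form /=.
move: ('D_(bvec R i) T0 x) ('D_(bvec R i) T1 x) => p q.
move: ('D_(bvec R 0) F (T x)) ('D_(bvec R 1) F (T x)) => r s.
rewrite !mxE /= !mulr1 !mulr0 addr0 add0r.
by congr (_ + _); exact: mulrC.
Qed.

End chain_rule.

Section charts.
Variables (R : realType) (S : topologicalType) (M : smooth_surface R S).
Variable g : riemannian_metric M.
Variable u : S -> R.
Hypothesis u_smooth : smooth_function M u.

Local Notation dom c := (cmap c @` cdom c).

Lemma chart_metric (c : chart R S) : atlas M c -> exists U0, metric_on U0 (dom c) (metric g c).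
Proof.
move=> ac; have [U [oU UE]] := cimg_open c; exists U; split=> //.
- exact: (metric_smooth g ac).
- by move=> x [p cp <-]; exact: (Defs.metric_sym g ac cp).
- by move=> x [p cp <-] v; exact: (metric_pos g ac cp).
Qed.

(** Transition maps are smooth on the image of the overlap; openness of [cdom d] and continuity of
    [cinv c] make this image relatively open in the half-plane. *)
Lemma near_chart_overlap (c d : chart R S) p : cdom c p -> cdom d p ->
  \forall z \near cmap c p, half_plane z -> (cmap c @` (cdom c `&` cdom d)) z.
Proof.
move=> cp dp; have Dx : dom c (cmap c p) by exists p.
have [U [oU UE]] := cimg_open c.
have Ux : U (cmap c p) by move: Dx; rewrite UE => -[].
have nd : nbhs (cinv c (cmap c p)) (cdom d).
  by rewrite cmapK//; apply: open_nbhs_nbhs; split=> //; exact: cdom_open.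
have := @cinv_continuous _ _ c (cmap c p) _ nd.
rewrite /nbhs /= -nbhs_subspace_in// => nz.
have nz' : \forall z \near cmap c p, dom c z -> cdom d (cinv c z) by [].
near=> z => Hz.
have Dz : dom c z by rewrite UE; split=> //; near: z; exact: open_nbhs_nbhs.
have dz : cdom d (cinv c z) by move: Dz; near: z.
move: Dz dz => [p' cp' <-]; rewrite cmapK// => dp'.
by exists p'.
Unshelve. all: by end_near. Qed.

(** The chain rule is applied to extensions: [T] extends the transition map and [F] extends u in the
    second chart. Off the half-plane [T] may leave the second chart, so [F \o T] is compared with u
    only on the half-plane, which is all that [pderiv_ext] asks for. *)
Lemma pderiv_transition (c d : chart R S) p i : atlas M c -> atlas M d -> cdom c p -> cdom d p ->
  pderiv i (u \o cinv c) (cmap c p) =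
  \sum_(k < 2) pderiv k (u \o cinv d) (cmap d p) *
    pderiv i (transition c d k) (cmap c p).
Proof.
move=> ac ad cp dp; set x := cmap c p; set y := cmap d p.
have [Uc [oUc UcE]] := cimg_open c; have [Ud [oUd UdE]] := cimg_open d.
have Ex : (cmap c @` (cdom c `&` cdom d)) x by exists p.
have Hx : half_plane x by have [] : (Uc `&` @half_plane R) x by rewrite -UcE; exists p.
have Dy : dom d y by exists p.
have Hy : half_plane y by have [] : (Ud `&` @half_plane R) y by rewrite -UdE; exists p.
have [V [F [oV Vy CF _ Ff]]] := smooth_ext oUd UdE (u_smooth ad) Dy.
have [V0 [T0 [oV0 V0x C0 E0]]] := atlas_smooth ac ad 0 Ex.
have [V1 [T1 [oV1 V1x C1 E1]]] := atlas_smooth ac ad 1 Ex.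
pose T z : plane R := T0 z *: bvec R 0 + T1 z *: bvec R 1.
have Tz p' : cdom c p' -> cdom d p' -> V0 (cmap c p') -> V1 (cmap c p') ->
    T (cmap c p') = cmap d p'.
  move=> cp' dp' V0p V1p; have Ez : (cmap c @` (cdom c `&` cdom d)) (cmap c p') by exists p'.
  apply: plane_eqP; rewrite !mxE /= !mulr1 !mulr0 ?addr0 ?add0r.
    by rewrite E0// /transition cmapK.
  by rewrite E1// /transition cmapK.
have Tx : T x = y by exact: Tz.
have cT : {for x, continuous T}.
  have [d0 _] := Cn1_diff oV0 V0x (C0 1%N); have [d1 _] := Cn1_diff oV1 V1x (C1 1%N).
  apply: differentiable_continuous; apply: differentiableD; exact: differentiableZl.
(* A common neighbourhood on which both extended components are valid, [T] lands in the domain of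
   [F], and half-plane points belong to the overlap. *)
have nB : nbhs x [set z | [/\ V0 z, V1 z, V (T z) &
    half_plane z -> (cmap c @` (cdom c `&` cdom d)) z]].
  near=> z; split; near: z.
  - exact: open_nbhs_nbhs.
  - exact: open_nbhs_nbhs.
  - by apply: cT; rewrite Tx; exact: open_nbhs_nbhs.
  - exact: near_chart_overlap.
move: nB; rewrite nbhsE => -[B [oB Bx] BP].
have oV01 : open (V0 `&` V1) by exact: openI.
have VTx : V (T x) by rewrite Tx.
have C0' : Cn 1 (V0 `&` V1) T0 by apply: Cn_subset (C0 1%N) => z [].
have C1' : Cn 1 (V0 `&` V1) T1 by apply: Cn_subset (C1 1%N) => z [].
have [dFT dFTE] := derive_comp_plane i oV01 (conj V0x V1x) C0' C1' oV VTx (CF 1%N).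
rewrite (pderiv_ext oB Bx Hx dFT); last first.
  move=> z Bz Hz; have [V0z V1z VTz /(_ Hz)[p' [cp' dp'] pz]] := BP z Bz.
  rewrite -pz in V0z V1z VTz *; rewrite /= cmapK//.
  have TE := Tz p' cp' dp' V0z V1z; rewrite /T in TE; rewrite TE.
  rewrite Ff /= ?cmapK//; first by rewrite -TE.
  by have [] : (Ud `&` @half_plane R) (cmap d p') by rewrite -UdE; exists p'.
rewrite dFTE !sum2 /=.
have Du k : pderiv k (u \o cinv d) y = 'D_(bvec R k) F y.
  exact: pderivE oV Vy Hy (CF 1%N) Ff.
have Dt0 : pderiv i (transition c d 0) x = 'D_(bvec R i) T0 x.
  have CB : Cn 1 B T0 by apply: Cn_subset (C0 1%N) => z /BP[].
  apply: (pderivE i oB Bx Hx CB) => z Bz Hz.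
  by have [V0z _ _ /(_ Hz) Ez] := BP z Bz; exact: E0.
have Dt1 : pderiv i (transition c d 1) x = 'D_(bvec R i) T1 x.
  have CB : Cn 1 B T1 by apply: Cn_subset (C1 1%N) => z /BP[].
  apply: (pderivE i oB Bx Hx CB) => z Bz Hz.
  by have [_ V1z _ /(_ Hz) Ez] := BP z Bz; exact: E1.
by rewrite Du Du Dt0 Dt1 -Tx.
Unshelve. all: by end_near. Qed.

(** This makes the P-function a well-defined function on [S]. *)
Lemma grad_sq_transition (c d : chart R S) p : atlas M c -> atlas M d -> cdom c p -> cdom d p ->
  grad_sq (metric g c) (u \o cinv c) (cmap c p) =
  grad_sq (metric g d) (u \o cinv d) (cmap d p).
Proof.
move=> ac ad cp dp.
have [Uc gcH] := chart_metric ac; have [Ud gdH] := chart_metric ad.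
have Dx : dom c (cmap c p) by exists p.
have Dy : dom d (cmap d p) by exists p.
rewrite (grad_sqE gcH _ Dx) (grad_sqE gdH _ Dy).
rewrite (pderiv_transition 0 ac ad cp dp) (pderiv_transition 1 ac ad cp dp) !sum2.
have d0 := lt0r_neq0 (det_gt0 gcH Dx); rewrite (detD gcH Dx) in d0.
have JE := metric_change g ac ad cp dp; cbv zeta in JE.
have gE i j : metric g c (cmap c p) i j =
   ((transition_jacobian c d (cmap c p))^T *m metric g d (cmap d p)
     *m transition_jacobian c d (cmap c p)) i j by rewrite -JE.
have J k i : transition_jacobian c d (cmap c p) k i =
  pderiv i (transition c d k) (cmap c p) by rewrite mxE.
have := gE 1 1; have := gE 0 1; have := gE 0 0.
rewrite !mxE !sum2 !mxE !sum2 !mxE (g10 gdH Dy).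
move: (metric g c (cmap c p) 0 0) (metric g c (cmap c p) 0 1) (metric g c (cmap c p) 1 1) d0.
move=> a' b' c' d0 Ea Eb Ec.
exact: (dual_form_change _ _ Ea Eb Ec d0).
Qed.

End charts.

(** * From a vanishing gradient to a constant function *)

Lemma connected_locally_cst (R : realType) (S : topologicalType) (u : S -> R) :
  connected [set: S] -> (forall p, \forall p' \near p, u p' = u p) ->
  forall p p', u p = u p'.
Proof.
move=> Sc lc p p'.
(* Every set defined by values of [u] is open; taken with its complement, this makes each level set
   both open and closed. *)
have o (P : R -> Prop) : open [set z | P (u z)].
  rewrite openE => z Pz; rewrite /interior /=.
  by have := lc z; apply: filterS => z' /= ->.
have E : [set z | u z = u p] = [set: S].
  apply: Sc.
  - by exists p.
  - by exists [set z | u z = u p]; [exact: (o (fun r => r = u p))|rewrite setTI].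
  - exists [set z | u z = u p]; last by rewrite setTI.
    rewrite -[X in closed X]setCK; apply: open_closedC.
    exact: (o (fun r => r <> u p)).
by have : [set: S] p' by []; rewrite -E.
Qed.

Lemma cmap_continuous_at (R : realType) (S : topologicalType) (c : chart R S) (p : S) :
  cdom c p -> {for p, continuous (cmap c)}.
Proof.
move=> cp; have := @cmap_continuous _ _ c.
rewrite continuous_open_subspace; last exact: cdom_open.
by apply; exact/mem_set.
Qed.

(** The half-plane is convex, so the segment from [x] to [y] stays where the extension agrees with
    [f], and the mean value theorem applies along it. *)
Lemma critical_locally_cst (R : realType) (U0 D : set (plane R)) (f : plane R -> R) x :
  open U0 -> D = U0 `&` @half_plane R -> smooth_on D f ->
  (forall i y, D y -> pderiv i f y = 0) -> D x ->
  \forall y \near x, half_plane y -> f y = f x.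
Proof.
move=> oU0 DE sf df Dx; have Hx := D_half DE Dx.
have [V [F [oV Vx CF VD Ff]]] := smooth_ext oU0 DE sf Dx.
have [d d0 dP] : exists2 d : R, 0 < d & forall y, `|y - x| < d -> V y.
  by apply: near_plane; exact: open_nbhs_nbhs.
apply/nbhs_ballP; exists d => //= y; rewrite -ball_normE /= distrC => yd Hy.
have Vt t : 0 <= t <= 1 -> V (x + t *: (y - x)) /\ half_plane (x + t *: (y - x)).
  move=> /andP[t0 t1]; split.
    apply: dP; rewrite addrAC subrr add0r normrZ ger0_norm//.
    by apply: le_lt_trans yd; rewrite ler_piMl.
  rewrite /half_plane /= !mxE; rewrite /half_plane /= in Hx Hy.
  have -> : x 0 1 + t * (y 0 1 - x 0 1) = (1 - t) * x 0 1 + t * y 0 1 by ring.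
  by rewrite addr_ge0// mulr_ge0// subr_ge0.
have dF z : V z -> half_plane z -> is_derive z (y - x) F 0.
  move=> Vz Hz; apply: is_derive_eq (Cn1_derive _ oV Vz (CF 1%N)) _.
  rewrite -!(pderivE _ oV Vz Hz (CF 1%N) Ff) !df ?mulr0 ?addr0//; exact: VD.
have [t t01|t /andP[t0 t1]] := @MVT_line_pos R F x (y - x) 1 ltr01.
  by have [Vz Hz] := Vt t t01; have [] := dF _ Vz Hz.
have [|Vz Hz] := Vt t; first by rewrite !ltW.
have [_ ->] := dF _ Vz Hz; rewrite scale1r subrKC mulr0 => /eqP.
by rewrite subr_eq0 Ff// ?Ff// => [/eqP//|]; exact: dP.
Qed.

Theorem theorem3 (R : realType) (S : topologicalType)
    (M : smooth_surface R S) (g : riemannian_metric M)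
    (S_compact : compact [set: S]) (S_connected : connected [set: S])
    (S_boundary : boundary M !=set0)
    (K_ge0 : nonneg_gauss_curvature g)
    (kappa_ge1 : geodesic_curvature_ge g 1)
    (q lambda : R) (q_gt1 : 1 < q)
    (lambda_gt0 : 0 < lambda) (lambda_le : lambda <= (q - 1)^-1)
    (u : S -> R) (u_smooth : smooth_function M u)
    (u_gt0 : forall p, 0 < u p)
    (u_harmonic : harmonic_function g u)
    (u_boundary : nonlinear_robin g lambda q u) :
  exists a : R, forall p, u p = a.
Proof.
have [pb _] := S_boundary.
have q0 : 0 < q := lt_trans ltr01 q_gt1.
(* A chart is chosen at each point to define the global function [P]; [PE] then removes the
   dependence on the choice. *)
have cover p : {c | atlas M c & cdom c p}.
  by apply: cid2; exact: atlas_cover.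
pose ch p : chart R S := s2val (cover p).
have chA p : atlas M (ch p) := s2valP (cover p).
have chD p : cdom (ch p) p := s2valP' (cover p).
pose Pc (c : chart R S) := p_function (metric g c) q lambda (u \o cinv c).
pose P p := Pc (ch p) (cmap (ch p) p).
have PE c p : atlas M c -> cdom c p -> P p = Pc c (cmap c p).
  move=> ac cp; rewrite /P /Pc /p_function /= (cmapK cp) (cmapK (chD p)).
  by rewrite (grad_sq_transition g u_smooth (chA p) ac (chD p) cp).
have uc_gt0 (c : chart R S) x : 0 < (u \o cinv c) x by exact: u_gt0.
have cP : continuous P.
  move=> p; have ac := chA p; have cp := chD p.
  set c := ch p in ac cp.
  have [U0 gH] := chart_metric g ac.
  have Dx : (cmap c @` cdom c) (cmap c p) by exists p.
  have sP : smooth_on (cmap c @` cdom c) (Pc c).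
    exact: (smooth_p_function gH q lambda_gt0 (u_smooth _ ac) (fun x _ => uc_gt0 c x)).
  have [V [F [oV Vx CF VD Ff]]] := smooth_ext (dom_open gH) (dom_half gH) sP Dx.
  have ccm : {for p, continuous (cmap c)} := cmap_continuous_at cp.
  (* The chart chosen at nearby points may jump, but [PE] allows the chart at [p] to be used for all
     of them. *)
  apply: (@near_eq_continuous R S p (F \o cmap c) P); last first.
    by apply: continuous_comp => //; exact: Cn_cont (CF 0%N) Vx.
  near=> p'.
  have cp' : cdom c p' by near: p'; apply: open_nbhs_nbhs; split=> //; exact: cdom_open.
  have Vp' : V (cmap c p') by near: p'; apply: ccm; exact: open_nbhs_nbhs.
  rewrite (PE c p' ac cp') /= Ff//.
  by apply: (D_half (dom_half gH)); exists p'.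
(* The boundary point [pb] supplies the nonemptiness needed for the extreme value theorem. *)
have [p0 _ pmax] := @compact_EVT_max S R P setT (ex_intro _ pb I) S_compact
  (continuous_subspaceT cP).
have local c p : atlas M c -> cdom c p ->
    exists U0, [/\ metric_on U0 (cmap c @` cdom c) (metric g c) & (cmap c @` cdom c) (cmap c p)].
  by move=> ac cp; have [U0 gH] := chart_metric g ac; exists U0; split=> //; exists p.
have P0 : P p0 <= 0.
  have ac := chA p0; have cp := chD p0; set c := ch p0 in ac cp.
  have [U0 [gH Dx]] := local c p0 ac cp.
  rewrite leNgt; apply/negP => Pp0.
  apply: (@p_function_max R U0 _ _ gH q lambda q_gt1 lambda_gt0 lambda_le (u \o cinv c)
    (u_smooth _ ac) _ _ _ _ _ (cmap c p0) Dx).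
  - by move=> x _; exact: u_gt0.
  - by move=> x [p cp' <-]; exact: u_harmonic.
  - by move=> x [p cp' <-]; exact: K_ge0.
  - by move=> x [p cp' <-] x1; apply: kappa_ge1 => //; exists c.
  - move=> x [p cp' <-] x1; rewrite [(u \o cinv c) _]/= (cmapK cp').
    by apply: u_boundary => //; exists c.
  - move=> y [p cp' <-]; rewrite -/(Pc c _) -(PE c p ac cp') -/(Pc c _) -(PE c p0 ac cp).
    by apply: pmax; exact/mem_set.
  - move: Pp0; rewrite (PE c p0 ac cp) /Pc /p_function pmulr_lgt0// powR_gt0//.
    by rewrite addr_gt0 ?root_value_gt0.
(* [P] is bounded by its maximum, which is nonpositive, and the weight is positive: the squared
   gradient is nonpositive everywhere. *)
have crit c : atlas M c -> forall i x, (cmap c @` cdom c) x -> pderiv i (u \o cinv c) x = 0.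
  move=> ac i x [p cp <-]; have [U0 [gH Dx]] := local c p ac cp.
  apply: (grad_sq_eq0 gH) => //.
  have : P p <= 0 by apply: le_trans P0; apply: pmax; exact/mem_set.
  rewrite (PE c p ac cp) /Pc /p_function pmulr_lle0// powR_gt0//.
  by rewrite addr_gt0 ?root_value_gt0.
exists (u pb) => p; apply: connected_locally_cst => // {}p.
have ac := chA p; have cp := chD p; set c := ch p in ac cp.
have [U0 [gH Dx]] := local c p ac cp.
have ccm : {for p, continuous (cmap c)} := cmap_continuous_at cp.
have L := critical_locally_cst (dom_open gH) (dom_half gH) (u_smooth _ ac) (crit c ac) Dx.
near=> p'.
have cp' : cdom c p' by near: p'; apply: open_nbhs_nbhs; split=> //; exact: cdom_open.
have Lp : half_plane (cmap c p') -> (u \o cinv c) (cmap c p') = (u \o cinv c) (cmap c p).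
  by near: p'; exact: (ccm _ L).
move: Lp; rewrite /= (cmapK cp') (cmapK cp); apply.
by apply: (D_half (dom_half gH)); exists p'.
Unshelve. all: by end_near. Qed.
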